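(* Assuming the Strong Exponential Time Hypothesis (SETH), for no $\alpha>0$ is there an algorithm that, given a homogeneous regular expression $\mathcal{A}$ of type $\circ +$ of size $m$ and a homogeneous regular expression $\mathcal{B}$ of type $\circ |$ of size $n$, decides whether $\mathcal{L}(\mathcal{A})\cap\mathcal{L}(\mathcal{B})\neq\emptyset$ in time $\mathcal{O}((mn)^{1-\alpha})$.
   Context: Regular expressions over an alphabet $\Sigma$ are built from letters with concatenation $\circ$, union $|$, Kleene plus $+$ ($\mathcal{L}(\mathcal{C}^+)$ is the set of concatenations of $k\ge 1$ words of $\mathcal{L}(\mathcal{C})$) and Kleene star $*$ ($\mathcal{L}(\mathcal{C}^* )=\mathcal{L}(\mathcal{C}^+)\cup\{\epsilon\}$). A regular expression is viewed as a rooted tree whose leaves are letters and whose inner nodes are operators ($+,*$ have one child; $\circ,|$ may have several). The size of a regular expression is the number of leaves of its tree. It is homogeneous of type $t_1t_2$ (depth 2), with $t_1\neq t_2\in\{\circ,|,+,*\}$, if its root is labelled $t_1$, every inner node at depth 1 is labelled $t_2$, the children of depth-1 inner nodes are leaves, and the tree has depth 3. Thus a regexp of type $\circ+$ is a concatenation of symbols each of the form $c$ or $c^+$ ($c\in\Sigma$), and a regexp of type $\circ|$ is a concatenation of symbols each being a letter or a union of letters. The Strong Exponential Time Hypothesis states that for every $\epsilon>0$ there is $k$ such that $k$-SAT on $n$ variables cannot be solved in time $\mathcal{O}(2^{(1-\epsilon)n})$. *)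

(* Defs.v *)
From Stdlib Require Import Arith List Reals.
Import ListNotations.

(** * Regular expressions *)

(** The alphabet of an expression is the finite set of letters occurring in
    it; letters are drawn from [nat], so the alphabet is part of the input. *)
Definition letter := nat.
Definition word := list letter.
Definition language := word -> Prop.

Inductive operator := OConcat | OUnion | OPlus | OStar.

Inductive regex :=
| Letter (c : letter)
| Concat (rs : list regex)
| Union (rs : list regex)
| Plus (r : regex)
| Star (r : regex).

Definition lang_eps : language := fun w => w = [].
Definition lang_cat (L1 L2 : language) : language :=
  fun w => exists u v, w = u ++ v /\ L1 u /\ L2 v.
Definition lang_empty : language := fun _ => False.
Definition lang_union (L1 L2 : language) : language := fun w => L1 w \/ L2 w.
Definition lang_plus (L : language) : language :=
  fun w => exists ws, ws <> [] /\ Forall L ws /\ w = concat ws.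

Fixpoint lang (r : regex) : language :=
  match r with
  | Letter c => fun w => w = [c]
  | Concat rs => fold_right lang_cat lang_eps (map lang rs)
  | Union rs => fold_right lang_union lang_empty (map lang rs)
  | Plus r => lang_plus (lang r)
  | Star r => lang_union (lang_plus (lang r)) lang_eps
  end.

(** [None] marks a leaf. *)
Definition label (r : regex) : option operator :=
  match r with
  | Letter _ => None
  | Concat _ => Some OConcat
  | Union _ => Some OUnion
  | Plus _ => Some OPlus
  | Star _ => Some OStar
  end.

Definition children (r : regex) : list regex :=
  match r with
  | Letter _ => []
  | Concat rs | Union rs => rs
  | Plus r | Star r => [r]
  end.

(** The leaves are exactly the letters: every operator has a child. *)
Fixpoint well_formed (r : regex) : Prop :=
  match r with
  | Letter _ => True
  | Concat rs | Union rs => rs <> [] /\ fold_right and True (map well_formed rs)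
  | Plus r | Star r => well_formed r
  end.

Fixpoint size (r : regex) : nat :=
  match r with
  | Letter _ => 1
  | Concat rs | Union rs => list_sum (map size rs)
  | Plus r | Star r => size r
  end.

(** Depth counts levels of nodes, so a single leaf has depth 1. *)
Fixpoint depth (r : regex) : nat :=
  match r with
  | Letter _ => 1
  | Concat rs | Union rs => S (list_max (map depth rs))
  | Plus r | Star r => S (depth r)
  end.

Definition homogeneous (t1 t2 : operator) (r : regex) : Prop :=
  t1 <> t2 /\ well_formed r /\ label r = Some t1 /\
  (forall s, In s (children r) -> label s <> None ->
     label s = Some t2 /\ forall l, In l (children s) -> label l = None) /\
  depth r = 3.

(** Prefix notation, one machine word per token. *)
Fixpoint encode_regex (r : regex) : list nat :=
  match r with
  | Letter c => [0; c]
  | Concat rs => 1 :: length rs :: concat (map encode_regex rs)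
  | Union rs => 2 :: length rs :: concat (map encode_regex rs)
  | Plus r => 3 :: encode_regex r
  | Star r => 4 :: encode_regex r
  end.

(** * Conjunctive normal forms *)

(** The literal [(v, true)] is the variable [v], [(v, false)] its negation. *)
Definition literal := (nat * bool)%type.
Definition clause := list literal.

Record cnf := { num_vars : nat; clauses : list clause }.

(** Clauses do not repeat, so that for fixed [k] a formula on [n] variables
    has length polynomial in [n]; otherwise a time bound in terms of [n] alone
    would be meaningless. *)
Definition kcnf (k : nat) (F : cnf) : Prop :=
  NoDup (clauses F) /\
  forall C, In C (clauses F) ->
    length C <= k /\ forall l, In l C -> fst l < num_vars F.

Definition satisfiable (F : cnf) : Prop :=
  exists a : nat -> bool,
    forall C, In C (clauses F) -> exists l, In l C /\ a (fst l) = snd l.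

Definition encode_literal (l : literal) : nat :=
  2 * fst l + (if snd l then 1 else 0).

Definition encode_cnf (F : cnf) : list nat :=
  num_vars F :: length (clauses F) ::
  concat (map (fun C => length C :: map encode_literal C) (clauses F)).

(** * Word RAM *)

(** Registers and memory cells hold words, i.e. numbers below [2 ^ w].  Every
    instruction and every test takes unit time.  Control is structured, which
    costs only a constant factor compared with jumps. *)
Inductive binop :=
| Add | Sub | Mul | Div | Mod
| BitAnd | BitOr | BitXor | ShiftL | ShiftR
| Eq | Lt.

Inductive program :=
| Skip
| Const (d c : nat)                (* R[d] := c *)
| Op (o : binop) (d a b : nat)     (* R[d] := R[a] o R[b] *)
| Read (d a : nat)                 (* R[d] := M[R[a]] *)
| Write (a b : nat)                (* M[R[a]] := R[b] *)
| Seq (p q : program)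
| If (a : nat) (p q : program)     (* taken when R[a] <> 0 *)
| While (a : nat) (p : program).   (* repeated while R[a] <> 0 *)

Record state := { reg : nat -> nat; mem : nat -> nat }.

Definition update (f : nat -> nat) (i v : nat) : nat -> nat :=
  fun j => if j =? i then v else f j.
Definition set_reg (s : state) (i v : nat) : state :=
  {| reg := update (reg s) i v; mem := mem s |}.
Definition set_mem (s : state) (i v : nat) : state :=
  {| reg := reg s; mem := update (mem s) i v |}.

Definition eval_binop (w : nat) (o : binop) (a b : nat) : nat :=
  match o with
  | Add => a + b
  | Sub => a + (2 ^ w - b)
  | Mul => a * b
  | Div => a / b
  | Mod => a mod b
  | BitAnd => Nat.land a b
  | BitOr => Nat.lor a b
  | BitXor => Nat.lxor a b
  | ShiftL => Nat.shiftl a b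
  | ShiftR => Nat.shiftr a b
  | Eq => if a =? b then 1 else 0
  | Lt => if a <? b then 1 else 0
  end mod 2 ^ w.

(** [exec w p s t s']: with word length [w], started in [s], the program [p]
    halts in [s'] after [t] steps. *)
Inductive exec (w : nat) : program -> state -> nat -> state -> Prop :=
| exec_skip s : exec w Skip s 1 s
| exec_const d c s : exec w (Const d c) s 1 (set_reg s d (c mod 2 ^ w))
| exec_op o d a b s :
    exec w (Op o d a b) s 1 (set_reg s d (eval_binop w o (reg s a) (reg s b)))
| exec_read d a s : exec w (Read d a) s 1 (set_reg s d (mem s (reg s a)))
| exec_write a b s : exec w (Write a b) s 1 (set_mem s (reg s a) (reg s b))
| exec_seq p q s t s' t' s'' :
    exec w p s t s' -> exec w q s' t' s'' -> exec w (Seq p q) s (t + t') s''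
| exec_if_true a p q s t s' :
    reg s a <> 0 -> exec w p s t s' -> exec w (If a p q) s (S t) s'
| exec_if_false a p q s t s' :
    reg s a = 0 -> exec w q s t s' -> exec w (If a p q) s (S t) s'
| exec_while_true a p s t s' t' s'' :
    reg s a <> 0 -> exec w p s t s' -> exec w (While a p) s' t' s'' ->
    exec w (While a p) s (S (t + t')) s''
| exec_while_false a p s : reg s a = 0 -> exec w (While a p) s 1 s.

(** The input occupies the first memory cells, its length is in register 0,
    and everything else is zero. *)
Definition initial (x : list nat) : state :=
  {| reg := update (fun _ => 0) 0 (length x); mem := fun i => nth i x 0 |}.

(** * Decision problems and their complexity *)

Record problem := {
  instance : Type;
  valid : instance -> Prop;
  answer : instance -> Prop;
  encode : instance -> list nat
}.

(** [solvable_in_time P T]: one program decides every valid instance [x] of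
    [P] in [O(T x)] steps.

    - The word length is that of the transdichotomous model: the program has to
      work for every [w >= c * log2 (2 + T x + N)], where [N] is the length of
      the input, as long as the input tokens fit in words.
    - Time linear in the length of the input is always granted.  Without this,
      inputs that are too long to be read within [T x] steps (for [T] of the
      form [(mn)^(1-alpha)], those with [m] constant and [n] large) would make
      lower bounds hold for trivial reasons.  For k-SAT with [T] exponential in
      the number of variables the extra term is absorbed by [T]. *)
Definition solvable_in_time (P : problem) (T : instance P -> R) : Prop :=
  exists (p : program) (c : nat),
  forall x : instance P, valid P x ->
  forall w : nat,
    Forall (fun v => v < 2 ^ w) (encode P x) ->
    ((2 + T x + INR (length (encode P x))) ^ c <= 2 ^ w)%R ->
    exists (t : nat) (s : state),
      exec w p (initial (encode P x)) t s /\
      (INR t <= INR c * (T x + INR (length (encode P x))))%R /\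
      (reg s 0 <> 0 <-> answer P x).

Definition k_SAT (k : nat) : problem := {|
  instance := cnf;
  valid := kcnf k;
  answer := satisfiable;
  encode := encode_cnf
|}.

Definition SETH : Prop :=
  forall eps : R, (0 < eps)%R ->
  exists k : nat,
    ~ solvable_in_time (k_SAT k)
        (fun F => Rpower 2 ((1 - eps) * INR (num_vars F))).

(** Given [A] homogeneous of type [a1 a2] and [B] homogeneous of type [b1 b2],
    do their languages intersect? *)
Definition homogeneous_intersection (a1 a2 b1 b2 : operator) : problem := {|
  instance := regex * regex;
  valid := fun AB =>
    homogeneous a1 a2 (fst AB) /\ homogeneous b1 b2 (snd AB);
  answer := fun AB => exists u : word, lang (fst AB) u /\ lang (snd AB) u;
  encode := fun AB => encode_regex (fst AB) ++ encode_regex (snd AB)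
|}.

(* Main.v *)
From Stdlib Require Import Arith Bool List Reals Lia Lra FunctionalExtensionality.
Require Import Defs.
Import ListNotations.

(** Split the variables of a formula with clauses [C_1 .. C_m] into two halves,
    each with [N] assignments.  Write [x], [y], [#] for three letters and, for an
    assignment [u] of the left half, [u_k] for the truth value of [C_k] under
    [u].  The expression [A] is the concatenation over all [u] of
    [x^+ # u_1 .. u_m y^+], and [B] is

      [W^P {x} (concatenation over all v of {#,x,y} {x,y,1,not v_1} .. {x,y,1,not v_m}) {y} W^P],

    where [W] is the set of all letters and [P = N (m + 3)].  Between the two
    guards of [B] the expression [A] has to get from an [x] to a [y], which it
    can only do by reading some [# u_1 .. u_m] there; since [#] occurs only at
    the start of a block, this block belongs to some [v] such that [u] and [v]
    together satisfy all clauses.  Conversely, for such a pair the [x^+] and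
    [y^+] next to [u] absorb all other blocks, and the rest of [A] is read in the
    paddings.  Both sizes are [2^(n/2)] up to a polynomial factor, so an
    algorithm running in time [(|A| |B|)^(1 - alpha)] decides [k]-SAT in time
    [2^((1 - eps) n)] with an [eps] independent of [k]. *)

(** * The two languages *)

Definition hash : letter := 2.
Definition lx : letter := 3.
Definition ly : letter := 4.
Definition wild : list letter := [0; 1; hash; lx; ly].

Definition left_gadget (a : list bool) : list regex :=
  Plus (Letter lx) :: Letter hash ::
  map (fun s => Letter (Nat.b2n s)) a ++ [Plus (Letter ly)].

Definition left_expr (avs : list (list bool)) : regex :=
  Concat (flat_map left_gadget avs).

(** The letter [1] (satisfied) meets every set; the letter [0] only those of
    satisfied clauses. *)
Definition right_set (s : bool) : list letter := [lx; ly; 1; Nat.b2n (negb s)].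

Definition right_gadget (b : list bool) : list (list letter) :=
  [hash; lx; ly] :: map right_set b.

Definition right_sets (pad : nat) (bvs : list (list bool)) : list (list letter) :=
  repeat wild pad ++ [lx] :: flat_map right_gadget bvs ++ [ly] :: repeat wild pad.

Definition right_expr (pad : nat) (bvs : list (list bool)) : regex :=
  Concat (map (fun S => Union (map Letter S)) (right_sets pad bvs)).

(** The entries of [a] and [b] are the truth values of the clauses under the two
    half assignments. *)
Definition covers (a b : list bool) : Prop := Forall2 (fun s t => s || t = true) a b.

Lemma lang_concat_app (rs1 rs2 : list regex) (w : word) :
  lang (Concat (rs1 ++ rs2)) w <->
  exists u v, w = u ++ v /\ lang (Concat rs1) u /\ lang (Concat rs2) v.
Proof.
  cbn [lang]. revert w; induction rs1 as [|r rs1 IH]; intro w; simpl.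
  - split.
    + intro H; exists [], w; repeat split; auto.
    + intros (u & v & -> & -> & H); exact H.
  - split.
    + intros (u & v & -> & Hu & Hv).
      apply IH in Hv as (u' & v' & -> & Hu' & Hv').
      exists (u ++ u'), v'; split; [now rewrite app_assoc|]. split; [|assumption].
      exists u, u'; auto.
    + intros (u & v & -> & (u1 & u2 & -> & H1 & H2) & Hv).
      exists u1, (u2 ++ v); split; [now rewrite app_assoc|]. split; [assumption|].
      apply IH; exists u2, v; auto.
Qed.

Lemma lang_concat_cons (r : regex) (rs : list regex) (w : word) :
  lang (Concat (r :: rs)) w <->
  exists u v, w = u ++ v /\ lang r u /\ lang (Concat rs) v.
Proof. reflexivity. Qed.

Lemma lang_concat_letters (l w : word) :
  lang (Concat (map Letter l)) w <-> w = l.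
Proof.
  revert w; induction l as [|c l IH]; intro w; cbn [map].
  - reflexivity.
  - rewrite lang_concat_cons. split.
    + intros (u & v & -> & -> & Hv). apply IH in Hv as ->. reflexivity.
    + intros ->. exists [c], l. repeat split. now apply IH.
Qed.

Lemma lang_plus_letter (c : letter) (w : word) :
  lang (Plus (Letter c)) w <-> exists p, w = repeat c (S p).
Proof.
  cbn [lang]. split.
  - intros (ws & Hne & Hall & ->).
    exists (length ws - 1). destruct ws as [|w ws]; [easy|].
    clear Hne. rewrite length_cons. replace (S (S (length ws) - 1)) with (S (length ws)) by lia.
    change (S (length ws)) with (length (w :: ws)).
    induction Hall as [|v vs -> Hvs IH]; [reflexivity|].
    simpl. now rewrite IH.
  - intros (p & ->). exists (repeat [c] (S p)). split; [easy|]. split.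
    + apply Forall_forall. intros v Hv. now apply repeat_spec in Hv.
    + generalize (S p) as q; intro q. induction q as [|q IH]; simpl; congruence.
Qed.

Lemma lang_union_letters (S : list letter) (w : word) :
  lang (Union (map Letter S)) w <-> exists c, In c S /\ w = [c].
Proof.
  cbn [lang]. induction S as [|c S IH]; simpl.
  - split; [easy|]. now intros (c & [] & _).
  - split.
    + intros [->|H]; [now exists c; auto|]. apply IH in H as (d & Hd & ->). exists d; auto.
    + intros (d & [->|Hd] & ->); [now left|]. right; apply IH; now exists d.
Qed.

Lemma lang_concat_sets (Ss : list (list letter)) (w : word) :
  lang (Concat (map (fun S => Union (map Letter S)) Ss)) w <-> Forall2 (@In letter) w Ss.
Proof.
  revert w; induction Ss as [|S Ss IH]; intro w; cbn [map].
  - split; [intros ->; constructor | intro H; now inversion H].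
  - rewrite lang_concat_cons. split.
    + intros (u & v & -> & Hu & Hv). apply lang_union_letters in Hu as (c & Hc & ->).
      constructor; [assumption|now apply IH].
    + intro H. inversion H as [|c S' v Ss' Hc Hv]; subst.
      exists [c], v. split; [reflexivity|].
      split; [apply lang_union_letters; now exists c | now apply IH].
Qed.

Lemma lang_left_gadget (a : list bool) (w : word) :
  lang (Concat (left_gadget a)) w <->
  exists p q, w = repeat lx (S p) ++ hash :: map Nat.b2n a ++ repeat ly (S q).
Proof.
  unfold left_gadget.
  rewrite <- (map_map Nat.b2n Letter).
  change (Plus (Letter lx) :: Letter hash :: ?l)
    with ([Plus (Letter lx)] ++ ([Letter hash] ++ l)).
  split.
  - intro H.
    apply lang_concat_app in H as (u & v & -> & Hu & Hv).
    apply lang_concat_app in Hv as (v1 & v2 & -> & Hv1 & Hv2).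
    apply lang_concat_app in Hv2 as (v3 & v4 & -> & Hv3 & Hv4).
    apply lang_concat_letters in Hv3 as ->.
    apply (lang_concat_letters [hash]) in Hv1 as ->.
    apply lang_concat_cons in Hu as (u1 & u2 & -> & Hu1 & ->).
    apply lang_concat_cons in Hv4 as (z1 & z2 & -> & Hz1 & ->).
    apply lang_plus_letter in Hu1 as (p & ->).
    apply lang_plus_letter in Hz1 as (q & ->).
    exists p, q. now rewrite !app_nil_r.
  - intros (p & q & ->).
    apply lang_concat_app. eexists _, _; split; [reflexivity|]. split.
    { apply lang_concat_cons. eexists _, []; rewrite app_nil_r; split; [reflexivity|].
      split; [|reflexivity]. apply lang_plus_letter; now exists p. }
    apply lang_concat_app. exists [hash]; eexists; split; [reflexivity|].
    split; [now apply (lang_concat_letters [hash])|].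
    apply lang_concat_app. eexists _, _; split; [reflexivity|].
    split; [now apply lang_concat_letters|].
    apply lang_concat_cons. eexists _, []; rewrite app_nil_r; split; [reflexivity|].
    split; [|reflexivity]. apply lang_plus_letter; now exists q.
Qed.

Lemma right_set_covers (a b : list bool) (rest : word) (Ss : list (list letter)) :
  length a = length b ->
  Forall2 (@In letter) (map Nat.b2n a ++ rest) (map right_set b ++ Ss) -> covers a b.
Proof.
  revert b; induction a as [|s a IH]; intros [|t b] Hlen H; try discriminate.
  - constructor.
  - simpl in H. inversion H as [|? ? ? ? Hin Hrest]; subst.
    constructor; [|apply IH; auto].
    destruct s, t; simpl in Hin; unfold lx, ly in Hin; try reflexivity; intuition discriminate.
Qed.

Lemma hash_in_right_gadgets (bvs : list (list bool)) (pre post : list (list letter)) S :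
  flat_map right_gadget bvs = pre ++ S :: post -> In hash S ->
  exists b post', In b bvs /\ post = map right_set b ++ post'.
Proof.
  revert pre; induction bvs as [|b bvs IH]; intros pre Heq Hin.
  - destruct pre; discriminate.
  - destruct pre as [|S' pre]; simpl in Heq.
    + injection Heq as <- <-. exists b, (flat_map right_gadget bvs). split; [now left|reflexivity].
    + injection Heq as _ Heq.
      apply app_eq_app in Heq as (l & [[Hb Hl]|[Hpre Hl]]).
      * destruct l as [|S'' l]; simpl in Hl.
        -- destruct (IH [] (eq_sym Hl) Hin) as (b' & post' & Hb' & ->).
           exists b', post'; split; [now right|reflexivity].
        -- injection Hl as <- _. exfalso.
           assert (HS : In S (map right_set b)) by (rewrite Hb; apply in_or_app; right; now left).
           apply in_map_iff in HS as ([|] & <- & _); simpl in Hin;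
             unfold hash, lx, ly in Hin; intuition discriminate.
      * destruct (IH _ Hl Hin) as (b' & post' & Hb' & ->).
        exists b', post'; split; [now right|reflexivity].
Qed.

Lemma app_not_in_prefix {T : Type} (u v w z : list T) (c : T) :
  ~ In c u -> u ++ v = w ++ c :: z -> exists w', w = u ++ w'.
Proof.
  intros Hu Heq. apply app_eq_app in Heq as (l & [[-> Hl]|[-> _]]); [|now exists l].
  destruct l as [|d l]; [exists []; now rewrite !app_nil_r|].
  injection Hl as <- _. exfalso; apply Hu, in_or_app; right; now left.
Qed.

Lemma b2n_bounds (c : nat) (a : list bool) : In c (map Nat.b2n a) -> c <= 1.
Proof. intro H. apply in_map_iff in H as ([|] & <- & _); simpl; lia. Qed.

(** Before the first [ly], the word reads [x^r # a] inside the right gadgets,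
    and [#] can only be read at the start of one of them. *)
Lemma gadget_match_covers (m r : nat) (a : list bool) (bvs : list (list bool)) (w rest z : word) :
  length a = m -> (forall b, In b bvs -> length b = m) ->
  repeat lx r ++ hash :: map Nat.b2n a ++ rest = w ++ ly :: z ->
  Forall2 (@In letter) w (flat_map right_gadget bvs) ->
  exists b, In b bvs /\ covers a b.
Proof.
  intros Ha Hbs Heq Hw.
  assert (Hpre : exists w', w = (repeat lx r ++ hash :: map Nat.b2n a) ++ w').
  { apply (app_not_in_prefix _ rest _ z ly).
    - intro H. apply in_app_or in H as [H|[H|H]].
      + apply repeat_spec in H; discriminate.
      + discriminate.
      + apply b2n_bounds in H. unfold ly in H; lia.
    - rewrite <- app_assoc. exact Heq. }
  destruct Hpre as (w' & ->). rewrite <- app_assoc in Hw.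
  apply Forall2_app_inv_l in Hw as (S1 & S2 & _ & HS2 & HS).
  simpl in HS2. inversion HS2 as [|? S ? S3 Hhash Hrest]; subst.
  destruct (hash_in_right_gadgets _ _ _ _ HS Hhash) as (b & post' & Hb & ->).
  exists b; split; [assumption|].
  eapply right_set_covers; [|exact Hrest]. symmetry; auto.
Qed.

Lemma left_word_covers (m : nat) (avs bvs : list (list bool)) (w1 w2 w3 : word) :
  (forall a, In a avs -> length a = m) -> (forall b, In b bvs -> length b = m) ->
  lang (left_expr avs) (w1 ++ lx :: w2 ++ ly :: w3) ->
  Forall2 (@In letter) w2 (flat_map right_gadget bvs) ->
  exists a b, In a avs /\ In b bvs /\ covers a b.
Proof.
  intros Has Hbs HA Hw2. unfold left_expr in HA.
  revert w1 HA; induction avs as [|a avs IH]; intros w1 HA.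
  - simpl in HA. destruct w1; discriminate.
  - cbn [flat_map] in HA. apply lang_concat_app in HA as (u & v & Heq & Hu & Hv).
    apply lang_left_gadget in Hu as (p & q & ->).
    assert (Hcase : (exists r rest, lx :: w2 ++ ly :: w3
                       = repeat lx (S r) ++ hash :: map Nat.b2n a ++ rest) \/
                    exists w1', v = w1' ++ lx :: w2 ++ ly :: w3).
    { rewrite <- app_assoc in Heq. symmetry in Heq.
      apply app_eq_app in Heq as (l & [[Hp Hl]|[Hw1 Hl]]).
      - destruct l as [|c l]; [discriminate Hl|].
        left. exists (length l), (repeat ly (S q) ++ v).
        assert (Hrep : c :: l = repeat lx (S (length l))).
        { change (S (length l)) with (length (c :: l)). apply Forall_eq_repeat, Forall_forall.
          intros d Hd. symmetry. apply (repeat_spec (S p)). rewrite Hp. apply in_or_app; now right. }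
        rewrite Hl, Hrep. simpl. now rewrite <- app_assoc.
      - right.
        assert (Hpre : exists w', l = (hash :: map Nat.b2n a ++ repeat ly (S q)) ++ w').
        { apply (app_not_in_prefix _ v _ (w2 ++ ly :: w3) lx); [|exact Hl].
          intro H. destruct H as [H|H]; [discriminate|].
          apply in_app_or in H as [H|H].
          - apply b2n_bounds in H; unfold lx in H; lia.
          - apply repeat_spec in H; discriminate. }
        destruct Hpre as (w' & ->). rewrite <- app_assoc in Hl.
        apply app_inv_head in Hl. now exists w'. }
    destruct Hcase as [(r & rest & Heq')|(w1' & ->)].
    + simpl in Heq'. injection Heq' as Heq'.
      destruct (gadget_match_covers m r a bvs w2 rest w3) as (b & Hb & Hcov); auto.
      { apply Has; now left. }
      exists a, b; split; [now left|auto].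
    + destruct (IH (fun a' Ha' => Has a' (or_intror Ha')) w1' Hv) as (a' & b & Ha' & H).
      exists a', b; split; [now right|assumption].
Qed.

Lemma Forall2_repeat_in (c : letter) (Ss : list (list letter)) (n : nat) :
  length Ss = n -> (forall S, In S Ss -> In c S) -> Forall2 (@In letter) (repeat c n) Ss.
Proof.
  intros <- H. induction Ss as [|S Ss IH]; simpl; constructor.
  - apply H; now left.
  - apply IH; intros S' HS'; apply H; now right.
Qed.

Lemma Forall2_wild (w : word) (n : nat) :
  length w = n -> Forall (fun c => c <= 4) w -> Forall2 (@In letter) w (repeat wild n).
Proof.
  intros <- H. induction H as [|c w Hc Hw IH]; simpl; constructor; auto.
  unfold wild, hash, lx, ly; simpl; lia.
Qed.

Definition short_word (a : list bool) : word := lx :: hash :: map Nat.b2n a ++ [ly].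

Lemma lang_short_words (avs : list (list bool)) :
  lang (left_expr avs) (flat_map short_word avs).
Proof.
  induction avs as [|a avs IH]; [reflexivity|].
  unfold left_expr; cbn [flat_map]. apply lang_concat_app.
  exists (short_word a), (flat_map short_word avs). split; [reflexivity|]. split; [|exact IH].
  apply lang_left_gadget. now exists 0, 0.
Qed.

Lemma length_flat_map_const {X Y : Type} (f : X -> list Y) (n : nat) (l : list X) :
  (forall x, In x l -> length (f x) = n) -> length (flat_map f l) = length l * n.
Proof.
  intro H. induction l as [|x l IH]; [reflexivity|].
  simpl. rewrite length_app, (H x (or_introl eq_refl)), IH; [reflexivity|].
  intros y Hy; apply H; now right.
Qed.

Lemma short_words_le4 (avs : list (list bool)) :
  Forall (fun c => c <= 4) (flat_map short_word avs).
Proof.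
  apply Forall_flat_map, Forall_forall. intros a _. unfold short_word.
  repeat constructor; unfold lx, hash, ly; auto. apply Forall_app; split; auto.
  apply Forall_forall; intros c Hc. apply b2n_bounds in Hc; lia.
Qed.

Lemma right_gadgets_contain (c : letter) (bvs : list (list bool)) S :
  c = lx \/ c = ly -> In S (flat_map right_gadget bvs) -> In c S.
Proof.
  intros Hc HS. apply in_flat_map in HS as (b & _ & [<-|HS]).
  - simpl; intuition.
  - apply in_map_iff in HS as (t & <- & _). simpl; intuition.
Qed.

Lemma covers_right_sets (a b : list bool) :
  covers a b -> Forall2 (@In letter) (map Nat.b2n a) (map right_set b).
Proof.
  induction 1 as [|s t a b Hst _ IH]; simpl; constructor; auto.
  destruct s, t; simpl; auto; discriminate.
Qed.

Lemma intersection_nonempty_iff (m : nat) (avs bvs : list (list bool)) :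
  (forall a, In a avs -> length a = m) -> (forall b, In b bvs -> length b = m) ->
  (exists u, lang (left_expr avs) u /\ lang (right_expr (length avs * (m + 3)) bvs) u) <->
  exists a b, In a avs /\ In b bvs /\ covers a b.
Proof.
  intros Has Hbs. set (pad := length avs * (m + 3)). split.
  - intros (w & HA & HB). apply lang_concat_sets in HB. unfold right_sets in HB.
    apply Forall2_app_inv_r in HB as (w1 & w' & _ & HB & ->).
    inversion HB as [|c S w'' Ss Hc HB']; subst. destruct Hc as [<-|[]].
    apply Forall2_app_inv_r in HB' as (w2 & w4 & Hw2 & HB' & ->).
    inversion HB' as [|c S w3 Ss Hc _]; subst. destruct Hc as [<-|[]].
    eapply left_word_covers; eauto.
  - intros (a & b & Ha & Hb & Hcov).
    destruct (in_split _ _ Ha) as (as1 & as2 & Eas).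
    destruct (in_split _ _ Hb) as (bs1 & bs2 & Ebs).
    set (w1 := flat_map short_word as1). set (w2 := flat_map short_word as2).
    assert (Hlen : forall l, (forall c, In c l -> In c avs) ->
              length (flat_map short_word l) = length l * (m + 3)).
    { intros l Hl. apply length_flat_map_const. intros c Hc. unfold short_word.
      simpl. rewrite length_app, length_map, (Has c (Hl c Hc)). simpl; lia. }
    assert (L1 : length w1 = length as1 * (m + 3)).
    { apply Hlen. intros c Hc. rewrite Eas. apply in_or_app; now left. }
    assert (L2 : length w2 = length as2 * (m + 3)).
    { apply Hlen. intros c Hc. rewrite Eas. apply in_or_app; right; now right. }
    assert (Epad : pad = length w1 + (m + 3) + length w2).
    { unfold pad. rewrite L1, L2, Eas, length_app. simpl. lia. }
    set (B1 := flat_map right_gadget bs1). set (B2 := flat_map right_gadget bs2).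
    exists (w1 ++ (repeat lx (pad - length w1) ++ repeat lx (S (length B1))) ++
       (hash :: map Nat.b2n a) ++
       (repeat ly (length B2 + 1) ++ repeat ly (pad - length w2)) ++ w2).
    split.
    + rewrite <- !repeat_app.
      replace (pad - length w1 + S (length B1))
        with (S (pad - length w1 + length B1)) by lia.
      replace (length B2 + 1 + (pad - length w2))
        with (S (length B2 + (pad - length w2))) by lia.
      rewrite Eas. unfold left_expr. rewrite flat_map_app.
      apply lang_concat_app. eexists _, _; split; [reflexivity|].
      split; [apply lang_short_words|].
      cbn [flat_map]. rewrite (app_assoc (hash :: _)), app_assoc.
      apply lang_concat_app. eexists _, _; split; [reflexivity|].
      split; [|apply lang_short_words].
      apply lang_left_gadget. eexists _, _; reflexivity.
    + apply lang_concat_sets. unfold right_sets.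
      rewrite Ebs, flat_map_app. cbn [flat_map]. fold B1 B2.
      replace (repeat wild pad ++ [lx] :: (B1 ++ right_gadget b ++ B2) ++ [ly] :: repeat wild pad)
        with (repeat wild (length w1) ++ (repeat wild (pad - length w1) ++ ([lx] :: B1)) ++
              right_gadget b ++ ((B2 ++ [[ly]]) ++ repeat wild (pad - length w2)) ++
              repeat wild (length w2)).
      2:{ replace (repeat wild pad) with (repeat wild (length w1) ++ repeat wild (pad - length w1)) at 1
            by (rewrite <- repeat_app; f_equal; lia).
          replace (repeat wild pad) with (repeat wild (pad - length w2) ++ repeat wild (length w2)) at 1
            by (rewrite <- repeat_app; f_equal; lia).
          repeat (rewrite <- ?app_assoc; simpl). reflexivity. }
      apply Forall2_app; [apply Forall2_wild; [reflexivity|apply short_words_le4]|].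
      apply Forall2_app; [apply Forall2_app|].
      * apply Forall2_repeat_in; [apply repeat_length|].
        intros S HS; apply repeat_spec in HS as ->. unfold wild; simpl; intuition.
      * apply Forall2_repeat_in; [reflexivity|].
        intros S [<-|HS]; [now left|]. eapply right_gadgets_contain; eauto.
      * apply Forall2_app; [|apply Forall2_app; [apply Forall2_app|]].
        -- constructor; [now left|]. now apply covers_right_sets.
        -- apply Forall2_repeat_in; [now rewrite length_app|].
           intros S HS. apply in_app_or in HS as [HS|[<-|[]]]; [|now left].
           eapply right_gadgets_contain; eauto.
        -- apply Forall2_repeat_in; [apply repeat_length|].
           intros S HS; apply repeat_spec in HS as ->. unfold wild; simpl; intuition.
        -- apply Forall2_wild; [reflexivity|apply short_words_le4].
Qed.

Lemma fold_right_and (rs : list regex) :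
  fold_right and True (map well_formed rs) <-> Forall well_formed rs.
Proof.
  induction rs as [|r rs IH]; simpl; [split; auto|].
  rewrite IH. split; [intros [? ?]; now constructor | intro H; now inversion H].
Qed.

Lemma homogeneous_concat (t2 : operator) (rs : list regex) :
  OConcat <> t2 ->
  (forall s, In s rs -> well_formed s /\
     (label s <> None -> label s = Some t2 /\ forall l, In l (children s) -> label l = None)) ->
  (exists s, In s rs /\ label s <> None) ->
  homogeneous OConcat t2 (Concat rs).
Proof.
  intros Ht Hrs (s0 & Hs0 & Hl0).
  assert (Hleaf : forall l, label l = None -> depth l = 1) by (intros []; easy).
  assert (Hd : forall s, In s rs -> depth s <= 2).
  { intros s Hs. destruct (Hrs s Hs) as [_ H].
    assert (Hl : label s <> None -> forall l, In l (children s) -> depth l = 1).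
    { intros Hn l Hlc. apply Hleaf. now apply H. }
    destruct s as [c|qs|qs|q|q]; simpl in *; auto.
    - apply le_n_S, list_max_le, Forall_forall. intros d Hdi.
      apply in_map_iff in Hdi as (l & <- & Hli). rewrite Hl; auto; discriminate.
    - apply le_n_S, list_max_le, Forall_forall. intros d Hdi.
      apply in_map_iff in Hdi as (l & <- & Hli). rewrite Hl; auto; discriminate.
    - rewrite Hl; auto; discriminate.
    - rewrite Hl; auto; discriminate. }
  assert (Hd0 : 2 <= depth s0).
  { assert (Hpos : forall r, 1 <= depth r) by (intros []; simpl; lia).
    destruct (Hrs s0 Hs0) as [Hwf _].
    destruct s0 as [c|[|q qs]|[|q qs]|q|q]; simpl in *; try easy; try tauto;
      pose proof (Hpos q); lia. }
  split; [assumption|]. split; [|split; [reflexivity|split]].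
  - simpl. split; [intros ->; inversion Hs0|].
    apply fold_right_and, Forall_forall. intros s Hs; now apply Hrs.
  - intros s Hs. now apply Hrs.
  - simpl. f_equal. apply Nat.le_antisymm.
    + apply list_max_le, Forall_forall. intros d Hdi.
      apply in_map_iff in Hdi as (l & <- & Hli). now apply Hd.
    + transitivity (depth s0); [assumption|].
      pose proof (proj1 (list_max_le (map depth rs) _) (le_n _)) as H.
      rewrite Forall_forall in H. apply H, in_map, Hs0.
Qed.

Lemma left_expr_homogeneous (avs : list (list bool)) :
  avs <> [] -> homogeneous OConcat OPlus (left_expr avs).
Proof.
  intro Hne. apply homogeneous_concat; [discriminate| |].
  - intros s Hs. apply in_flat_map in Hs as (a & _ & Hs).
    destruct Hs as [<-|[<-|Hs]].
    + split; [exact I|]. intros _; split; [reflexivity|]. now intros l [<-|[]].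
    + split; [exact I|]. easy.
    + apply in_app_or in Hs as [Hs|[<-|[]]].
      * apply in_map_iff in Hs as (t & <- & _). split; [exact I|]. easy.
      * split; [exact I|]. intros _; split; [reflexivity|]. now intros l [<-|[]].
  - destruct avs as [|a avs]; [easy|]. exists (Plus (Letter lx)). split; [now left|discriminate].
Qed.

Lemma right_sets_nonempty (pad : nat) (bvs : list (list bool)) S :
  In S (right_sets pad bvs) -> S <> [].
Proof.
  unfold right_sets. intros HS ->.
  apply in_app_or in HS as [HS|[HS|HS]].
  - apply repeat_spec in HS; discriminate.
  - discriminate.
  - apply in_app_or in HS as [HS|[HS|HS]].
    + destruct (right_gadgets_contain lx bvs [] (or_introl eq_refl) HS).
    + discriminate.
    + apply repeat_spec in HS; discriminate.
Qed.

Lemma right_expr_homogeneous (pad : nat) (bvs : list (list bool)) :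
  homogeneous OConcat OUnion (right_expr pad bvs).
Proof.
  apply homogeneous_concat; [discriminate| |].
  - intros s Hs. apply in_map_iff in Hs as (S & <- & HS).
    apply right_sets_nonempty in HS. split.
    + simpl. split; [now destruct S|].
      apply fold_right_and, Forall_forall. intros r Hr.
      apply in_map_iff in Hr as (c & <- & _). exact I.
    + intros _; split; [reflexivity|]. intros l Hl.
      apply in_map_iff in Hl as (c & <- & _). reflexivity.
  - exists (Union [Letter lx]). split; [|discriminate].
    change (Union [Letter lx]) with ((fun S => Union (map Letter S)) [lx]).
    apply in_map. unfold right_sets. apply in_or_app; right; now left.
Qed.

(** * Half assignments *)

(** The assignment whose bits are those of [u], on the variables [lo .. lo + h - 1] only. *)
Definition half_true (lo h u : nat) (l : literal) : bool :=
  (lo <=? fst l) && (fst l - lo <? h) && eqb (Nat.testbit u (fst l - lo)) (snd l).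

Definition half_sat (lo h u : nat) (C : clause) : bool := existsb (half_true lo h u) C.

Definition half_vector (lo h : nat) (cs : list clause) (u : nat) : list bool :=
  map (half_sat lo h u) cs.

Fixpoint down (n : nat) : list nat :=
  match n with O => [] | S n => n :: down n end.

Lemma in_down (n u : nat) : In u (down n) <-> u < n.
Proof. induction n as [|n IH]; simpl; [lia|]. rewrite IH. lia. Qed.

Lemma length_down (n : nat) : length (down n) = n.
Proof. induction n; simpl; congruence. Qed.

Definition half_vectors (lo h : nat) (cs : list clause) : list (list bool) :=
  map (half_vector lo h cs) (down (2 ^ h)).

Lemma length_half_vectors (lo h : nat) (cs : list clause) :
  length (half_vectors lo h cs) = 2 ^ h.
Proof. unfold half_vectors. now rewrite length_map, length_down. Qed.

Lemma length_in_half_vectors (lo h : nat) (cs : list clause) (a : list bool) :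
  In a (half_vectors lo h cs) -> length a = length cs.
Proof. intro H. apply in_map_iff in H as (u & <- & _). apply length_map. Qed.

Lemma bits_of_assignment (f : nat -> bool) (h : nat) :
  exists u, u < 2 ^ h /\ forall i, i < h -> Nat.testbit u i = f i.
Proof.
  revert f; induction h as [|h IH]; intro f.
  - exists 0. split; [simpl; lia|]. intros i Hi; lia.
  - destruct (IH (fun i => f (S i))) as (u & Hu & Hbits).
    exists (2 * u + Nat.b2n (f 0)). split.
    + rewrite Nat.pow_succ_r'. destruct (f 0); simpl Nat.b2n; lia.
    + intros [|i] Hi.
      * apply Nat.testbit_0_r.
      * rewrite Nat.testbit_succ_r. apply Hbits; lia.
Qed.

Lemma covers_map (f g : clause -> bool) (cs : list clause) :
  covers (map f cs) (map g cs) <-> forall C, In C cs -> f C || g C = true.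
Proof.
  unfold covers. induction cs as [|C cs IH]; simpl.
  - split; [easy|constructor].
  - split.
    + intros H D [<-|HD]; inversion H; subst; [assumption|]. now apply IH.
    + intro H. constructor; [apply H; now left|]. apply IH. intros D HD; apply H; now right.
Qed.

Lemma satisfiable_iff_halves (F : cnf) (h : nat) :
  (forall C l, In C (clauses F) -> In l C -> fst l < 2 * h) ->
  satisfiable F <->
  exists a b, In a (half_vectors 0 h (clauses F)) /\ In b (half_vectors h h (clauses F)) /\
              covers a b.
Proof.
  intro Hvars. split.
  - intros (f & Hf).
    destruct (bits_of_assignment f h) as (u & Hu & Hub).
    destruct (bits_of_assignment (fun i => f (h + i)) h) as (v & Hv & Hvb).
    exists (half_vector 0 h (clauses F) u), (half_vector h h (clauses F) v).
    split; [apply in_map, in_down, Hu|]. split; [apply in_map, in_down, Hv|].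
    apply covers_map. intros C HC. destruct (Hf C HC) as (l & Hl & Hfl).
    pose proof (Hvars C l HC Hl) as Hlt. apply orb_true_iff.
    destruct (Nat.lt_ge_cases (fst l) h) as [Hh|Hh]; [left|right];
      apply existsb_exists; exists l; (split; [assumption|]); unfold half_true;
      rewrite !andb_true_iff, Nat.leb_le, Nat.ltb_lt, eqb_true_iff.
    + rewrite Nat.sub_0_r, Hub by assumption. repeat split; auto; lia.
    + rewrite Hvb by lia. replace (h + (fst l - h)) with (fst l) by lia. repeat split; auto; lia.
  - intros (a & b & Ha & Hb & Hcov).
    apply in_map_iff in Ha as (u & <- & _). apply in_map_iff in Hb as (v & <- & _).
    exists (fun i => if i <? h then Nat.testbit u i else Nat.testbit v (i - h)).
    intros C HC. pose proof (proj1 (covers_map _ _ _) Hcov C HC) as HS.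
    apply orb_true_iff in HS as [HS|HS];
      apply existsb_exists in HS as (l & Hl & Ht); exists l; (split; [assumption|]);
      unfold half_true in Ht;
      rewrite !andb_true_iff, Nat.leb_le, Nat.ltb_lt, eqb_true_iff in Ht;
      destruct Ht as [[H1 H2] H3].
    + rewrite Nat.sub_0_r in H2, H3. now apply Nat.ltb_lt in H2 as ->.
    + now apply Nat.ltb_ge in H1 as ->.
Qed.

Definition left_tokens (a : list bool) : list nat :=
  [3; 0; 3; 0; 2] ++ flat_map (fun s => [0; Nat.b2n s]) a ++ [3; 0; 4].

Definition set_tokens (S : list letter) : list nat :=
  2 :: length S :: flat_map (fun c => [0; c]) S.

Lemma flat_map_flat_map {X Y Z : Type} (g : Y -> list Z) (f : X -> list Y) (l : list X) :
  flat_map g (flat_map f l) = flat_map (fun x => flat_map g (f x)) l.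
Proof. induction l as [|x l IH]; simpl; [reflexivity|]. now rewrite flat_map_app, IH. Qed.

Lemma flat_map_map {X Y Z : Type} (g : Y -> list Z) (f : X -> Y) (l : list X) :
  flat_map g (map f l) = flat_map (fun x => g (f x)) l.
Proof. induction l as [|x l IH]; simpl; congruence. Qed.

Lemma length_left_gadget (a : list bool) : length (left_gadget a) = length a + 3.
Proof. unfold left_gadget. simpl. rewrite length_app, length_map. simpl; lia. Qed.

Lemma encode_left_expr (m : nat) (avs : list (list bool)) :
  (forall a, In a avs -> length a = m) ->
  encode_regex (left_expr avs) = [1; length avs * (m + 3)] ++ flat_map left_tokens avs.
Proof.
  intro Hm. unfold left_expr. cbn [encode_regex].
  rewrite (length_flat_map_const _ (m + 3))
    by (intros a Ha; rewrite length_left_gadget, Hm; auto).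
  simpl. do 2 f_equal. rewrite <- flat_map_concat_map, flat_map_flat_map.
  apply flat_map_ext. intro a. unfold left_gadget, left_tokens. simpl.
  now rewrite flat_map_app, flat_map_map.
Qed.

Lemma encode_right_expr (pad : nat) (bvs : list (list bool)) :
  encode_regex (right_expr pad bvs) =
  [1; length (right_sets pad bvs)] ++ flat_map set_tokens (right_sets pad bvs).
Proof.
  unfold right_expr. cbn [encode_regex]. rewrite length_map. simpl. do 2 f_equal.
  rewrite map_map, <- flat_map_concat_map. apply flat_map_ext. intro S.
  unfold set_tokens. simpl. rewrite length_map. do 2 f_equal.
  now rewrite map_map, <- flat_map_concat_map.
Qed.

Lemma length_right_sets (m pad : nat) (bvs : list (list bool)) :
  (forall b, In b bvs -> length b = m) ->
  length (right_sets pad bvs) = pad + pad + 2 + length bvs * (m + 1).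
Proof.
  intro Hm. unfold right_sets.
  rewrite length_app, length_cons, length_app, length_cons, !repeat_length.
  rewrite (length_flat_map_const _ (m + 1)); [lia|].
  intros b Hb. simpl. rewrite length_map, Hm; auto. lia.
Qed.

Lemma size_left_expr (m : nat) (avs : list (list bool)) :
  (forall a, In a avs -> length a = m) ->
  size (left_expr avs) = length avs * (m + 3).
Proof.
  intro Hm. unfold left_expr. cbn [size].
  rewrite <- (length_flat_map_const left_gadget (m + 3))
    by (intros a Ha; rewrite length_left_gadget, Hm; auto).
  rewrite (map_ext_in _ (fun _ => 1)).
  - induction (flat_map left_gadget avs); simpl; congruence.
  - intros r Hr. apply in_flat_map in Hr as (a & _ & [<-|[<-|Hr]]); auto.
    apply in_app_or in Hr as [Hr|[<-|[]]]; auto.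
    apply in_map_iff in Hr as (s & <- & _). reflexivity.
Qed.

Lemma list_sum_le_const {X : Type} (f : X -> nat) (n : nat) (l : list X) :
  (forall x, In x l -> f x <= n) -> list_sum (map f l) <= length l * n.
Proof.
  intro H. induction l as [|x l IH]; simpl; [lia|].
  pose proof (H x (or_introl eq_refl)).
  assert (list_sum (map f l) <= length l * n) by (apply IH; intros y Hy; apply H; now right).
  lia.
Qed.

Lemma length_in_right_sets (pad : nat) (bvs : list (list bool)) S :
  In S (right_sets pad bvs) -> 1 <= length S <= 5 /\ Forall (fun c => c <= 4) S.
Proof.
  assert (Hw : forall S, S = wild -> 1 <= length S <= 5 /\ Forall (fun c => c <= 4) S).
  { intros ? ->. split; [simpl; lia|]. unfold wild, hash, lx, ly. repeat constructor. }
  assert (H1 : forall c, c <= 4 -> 1 <= length [c] <= 5 /\ Forall (fun c => c <= 4) [c]).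
  { intros c Hc. split; [simpl; lia|]. auto. }
  unfold right_sets. intro HS.
  apply in_app_or in HS as [HS|[<-|HS]];
    [apply Hw, (repeat_spec _ _ _ HS)|apply H1; unfold lx; lia|].
  apply in_app_or in HS as [HS|[<-|HS]];
    [|apply H1; unfold ly; lia|apply Hw, (repeat_spec _ _ _ HS)].
  apply in_flat_map in HS as (b & _ & [<-|HS]).
  - split; [simpl; lia|]. unfold hash, lx, ly. repeat constructor.
  - apply in_map_iff in HS as ([|] & <- & _);
      (split; [simpl; lia|]); unfold right_set, lx, ly; repeat constructor.
Qed.

Lemma size_right_expr (pad : nat) (bvs : list (list bool)) :
  1 <= size (right_expr pad bvs) <= length (right_sets pad bvs) * 5.
Proof.
  unfold right_expr. cbn [size]. rewrite map_map.
  assert (E : forall S, size (Union (map Letter S)) = length S).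
  { intro S. cbn [size]. rewrite map_map. cbn [size].
    induction S; simpl; congruence. }
  rewrite (map_ext _ _ E). split.
  - unfold right_sets. rewrite map_app, list_sum_app. simpl. lia.
  - apply list_sum_le_const. intros S HS. now apply length_in_right_sets in HS.
Qed.

(** * The reduction on the word RAM *)

Definition st (l : list nat) (m : nat -> nat) : state :=
  {| reg := fun i => nth i l 0; mem := m |}.

Fixpoint upd (l : list nat) (d v : nat) : list nat :=
  match l, d with
  | [], _ => []
  | _ :: l, 0 => v :: l
  | a :: l, S d => a :: upd l d v
  end.

Lemma nth_upd (l : list nat) (d v i : nat) :
  d < length l -> nth i (upd l d v) 0 = if i =? d then v else nth i l 0.
Proof.
  revert d i; induction l as [|a l IH]; intros d i H; [simpl in H; lia|].
  destruct d as [|d], i as [|i]; simpl in *; try reflexivity.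
  apply IH; lia.
Qed.

Lemma set_reg_st (l : list nat) (m : nat -> nat) (d v : nat) :
  d < length l -> set_reg (st l m) d v = st (upd l d v) m.
Proof.
  intro H. unfold set_reg, st. f_equal. apply functional_extensionality. intro i.
  simpl. now rewrite nth_upd.
Qed.

Definition runs (w T : nat) (p : program) (s s' : state) : Prop :=
  exists t, t <= T /\ exec w p s t s'.

Definition block (ps : list program) : program := fold_right Seq Skip ps.

Lemma runs_skip (w T : nat) (s s' : state) : s = s' -> 1 <= T -> runs w T Skip s s'.
Proof. intros -> HT. exists 1. split; [assumption|constructor]. Qed.

Lemma runs_seq (w T T1 : nat) (p q : program) (s s1 s2 : state) :
  runs w T1 p s s1 -> T1 <= T -> runs w (T - T1) q s1 s2 -> runs w T (Seq p q) s s2.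
Proof.
  intros (t1 & H1 & E1) HT (t2 & H2 & E2). exists (t1 + t2). split; [lia|].
  econstructor; eauto.
Qed.

Lemma runs_weaken (w T T' : nat) (p : program) (s s' : state) :
  runs w T p s s' -> T <= T' -> runs w T' p s s'.
Proof. intros (t & Ht & E) HT. exists t. split; [lia|assumption]. Qed.

Lemma runs_const (w T d c : nat) (l : list nat) (m : nat -> nat) (q : program) (s2 : state) :
  d < length l -> c < 2 ^ w -> 1 <= T ->
  runs w (T - 1) q (st (upd l d c) m) s2 -> runs w T (Seq (Const d c) q) (st l m) s2.
Proof.
  intros Hd Hc HT H. eapply runs_seq; [|exact HT|exact H].
  exists 1. split; [lia|]. rewrite <- set_reg_st by assumption.
  rewrite <- (Nat.mod_small c (2 ^ w)) at 2 by assumption. constructor.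
Qed.

Lemma runs_op (v w T : nat) (o : binop) (d a b : nat) (l : list nat) (m : nat -> nat)
    (q : program) (s2 : state) :
  d < length l -> eval_binop w o (nth a l 0) (nth b l 0) = v -> 1 <= T ->
  runs w (T - 1) q (st (upd l d v) m) s2 -> runs w T (Seq (Op o d a b) q) (st l m) s2.
Proof.
  intros Hd <- HT H. eapply runs_seq; [|exact HT|exact H].
  exists 1. split; [lia|]. rewrite <- set_reg_st by assumption.
  apply exec_op.
Qed.

Lemma runs_read (v w T d a : nat) (l : list nat) (m : nat -> nat) (q : program) (s2 : state) :
  d < length l -> m (nth a l 0) = v -> 1 <= T ->
  runs w (T - 1) q (st (upd l d v) m) s2 -> runs w T (Seq (Read d a) q) (st l m) s2.
Proof.
  intros Hd <- HT H. eapply runs_seq; [|exact HT|exact H].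
  exists 1. split; [lia|]. rewrite <- set_reg_st by assumption.
  apply exec_read.
Qed.

Lemma runs_write (m' : nat -> nat) (w T a b : nat) (l : list nat) (m : nat -> nat)
    (q : program) (s2 : state) :
  update m (nth a l 0) (nth b l 0) = m' -> 1 <= T ->
  runs w (T - 1) q (st l m') s2 -> runs w T (Seq (Write a b) q) (st l m) s2.
Proof.
  intros <- HT H. eapply runs_seq; [|exact HT|exact H].
  exists 1. split; [lia|]. apply (exec_write w a b (st l m)).
Qed.

Lemma runs_while_end (w T a : nat) (p : program) (l : list nat) (m : nat -> nat) s' :
  nth a l 0 = 0 -> st l m = s' -> 1 <= T -> runs w T (While a p) (st l m) s'.
Proof. intros Ha <- HT. exists 1. split; [assumption|]. now apply exec_while_false. Qed.

Lemma runs_while_step (w T T1 a : nat) (p : program) (l : list nat) (m : nat -> nat)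
    (s1 s2 : state) :
  nth a l 0 <> 0 -> runs w T1 p (st l m) s1 -> T1 + 1 <= T ->
  runs w (T - T1 - 1) (While a p) s1 s2 -> runs w T (While a p) (st l m) s2.
Proof.
  intros Ha (t1 & H1 & E1) HT (t2 & H2 & E2). exists (S (t1 + t2)). split; [lia|].
  eapply exec_while_true; eauto.
Qed.

Lemma eval_add (w a b : nat) : a + b < 2 ^ w -> eval_binop w Add a b = a + b.
Proof. intro H. now apply Nat.mod_small. Qed.

Lemma eval_mul (w a b : nat) : a * b < 2 ^ w -> eval_binop w Mul a b = a * b.
Proof. intro H. now apply Nat.mod_small. Qed.

Lemma eval_sub (w a b : nat) : b <= a -> a < 2 ^ w -> eval_binop w Sub a b = a - b.
Proof.
  intros Hb Ha. unfold eval_binop.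
  replace (a + (2 ^ w - b)) with (a - b + 1 * 2 ^ w) by lia.
  rewrite Nat.Div0.mod_add. apply Nat.mod_small; lia.
Qed.

Lemma eval_shiftr (w a b : nat) : a < 2 ^ w -> eval_binop w ShiftR a b = a / 2 ^ b.
Proof.
  intro H. unfold eval_binop. rewrite Nat.shiftr_div_pow2. apply Nat.mod_small.
  apply Nat.le_lt_trans with a; [|assumption].
  apply Nat.Div0.div_le_upper_bound. pose proof (Nat.pow_nonzero 2 b). nia.
Qed.

Lemma eval_shiftl_1 (w h : nat) : 2 ^ h < 2 ^ w -> eval_binop w ShiftL 1 h = 2 ^ h.
Proof.
  intro H. unfold eval_binop. rewrite Nat.shiftl_mul_pow2, Nat.mul_1_l.
  now apply Nat.mod_small.
Qed.

Lemma eval_and_1 (w a : nat) : 1 < 2 ^ w -> eval_binop w BitAnd a 1 = a mod 2.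
Proof.
  intro H. unfold eval_binop. change 1 with (Nat.ones 1) at 1.
  rewrite Nat.land_ones. apply Nat.mod_small.
  change (2 ^ 1) with 2. pose proof (Nat.mod_upper_bound a 2). lia.
Qed.

Lemma eval_lt (w a b : nat) : 1 < 2 ^ w -> eval_binop w Lt a b = Nat.b2n (a <? b).
Proof.
  intro H. unfold eval_binop. destruct (a <? b); apply Nat.mod_small; simpl; lia.
Qed.

Lemma eval_eq (w a b : nat) : 1 < 2 ^ w -> eval_binop w Eq a b = Nat.b2n (a =? b).
Proof.
  intro H. unfold eval_binop. destruct (a =? b); apply Nat.mod_small; simpl; lia.
Qed.

Lemma eval_and_b2n (w : nat) (a b : bool) :
  1 < 2 ^ w -> eval_binop w BitAnd (Nat.b2n a) (Nat.b2n b) = Nat.b2n (a && b).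
Proof.
  intro H. unfold eval_binop.
  destruct a, b; apply Nat.mod_small; simpl; lia.
Qed.

Lemma eval_or_b2n (w : nat) (a b : bool) :
  1 < 2 ^ w -> eval_binop w BitOr (Nat.b2n a) (Nat.b2n b) = Nat.b2n (a || b).
Proof.
  intro H. unfold eval_binop.
  destruct a, b; apply Nat.mod_small; simpl; lia.
Qed.

(** The output under construction lies below the address [d], a copy of the
    input from [d] on. *)
Definition layout (d : nat) (out x : list nat) : nat -> nat :=
  fun i => if i <? d then nth i out 0 else nth (i - d) x 0.

Lemma layout_read (d : nat) (out pre post : list nat) (v : nat) :
  layout d out (pre ++ v :: post) (d + length pre) = v.
Proof.
  unfold layout. rewrite (proj2 (Nat.ltb_ge _ _)) by lia.
  replace (d + length pre - d) with (length pre) by lia. apply nth_middle.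
Qed.

Lemma layout_emit (d v : nat) (out x : list nat) :
  length out < d ->
  update (layout d out x) (length out) v = layout d (out ++ [v]) x.
Proof.
  intro H. apply functional_extensionality. intro i. unfold update, layout.
  destruct (Nat.eqb_spec i (length out)) as [->|Hne].
  - rewrite (proj2 (Nat.ltb_lt _ _) H). now rewrite nth_middle.
  - destruct (i <? d); [|reflexivity].
    destruct (Nat.lt_ge_cases i (length out)) as [Hi|Hi].
    + now rewrite app_nth1.
    + rewrite !nth_overflow; [reflexivity| |lia]. rewrite length_app; simpl; lia.
Qed.

Lemma layout_erase (d v : nat) (out x : list nat) :
  length out < d ->
  update (layout d (out ++ [v]) x) (length out) 0 = layout d out x.
Proof.
  intro H. rewrite <- layout_emit by assumption.
  apply functional_extensionality. intro i. unfold update, layout.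
  destruct (Nat.eqb_spec i (length out)) as [->|Hne]; [|reflexivity].
  rewrite (proj2 (Nat.ltb_lt _ _) H). now rewrite nth_overflow.
Qed.

Lemma layout_write (d v v' : nat) (out pre post : list nat) :
  update (layout d out (pre ++ v :: post)) (d + length pre) v' =
  layout d out (pre ++ v' :: post).
Proof.
  apply functional_extensionality. intro i. unfold update, layout.
  destruct (Nat.eqb_spec i (d + length pre)) as [->|Hne].
  - rewrite (proj2 (Nat.ltb_ge _ _)) by lia.
    replace (d + length pre - d) with (length pre) by lia. now rewrite nth_middle.
  - destruct (Nat.ltb_spec i d); [reflexivity|].
    destruct (Nat.lt_trichotomy (i - d) (length pre)) as [Hi|[Hi|Hi]]; [|lia|].
    + now rewrite !app_nth1.
    + rewrite !app_nth2 by lia.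
      destruct (i - d - length pre) as [|k] eqn:E; [lia|reflexivity].
Qed.

(** Registers: 0 input length, 1 output pointer, 2 input pointer, 3 half
    assignment, 4 and 5 counters, 6 truth value of the current clause, 7-9
    scratch, 10 the constant 1, 11 the number of half assignments, 12 the
    number of clauses, 13 and 14 first variable and number of variables of the
    current half, 15 the address [d], 16 the padding. *)
Definition frame (xlen o i u k j s n m lo h d pad : nat) : list nat :=
  [xlen; o; i; u; k; j; s; 0; 0; 0; 1; n; m; lo; h; d; pad].

Ltac const := apply runs_const; [simpl; lia | lia | lia | cbn [upd]].
Ltac op v := apply (runs_op v); [simpl; lia | cbn [nth] | lia | cbn [upd]].
Ltac read v := apply (runs_read v); [simpl; lia | cbn [nth] | lia | cbn [upd]].
Ltac write m := apply (runs_write m); [cbn [nth] | lia | ].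

Definition literal_step : program := block
  [ Op Sub 5 5 10; Read 7 2; Op Add 2 2 10;
    Op BitAnd 9 7 10; Op ShiftR 7 7 10; Op Sub 7 7 13; Op Lt 8 7 14;
    Op ShiftR 7 3 7; Op BitAnd 7 7 10; Op Eq 7 7 9; Op BitAnd 7 7 8;
    Op BitOr 6 6 7; Const 7 0; Const 8 0; Const 9 0 ].

(** Truncation modulo [2 ^ w] makes the single comparison with [h] reject also
    the variables below [lo]. *)
Lemma half_true_wrap (w lo h u i : nat) (b : bool) :
  i < 2 ^ w -> lo + h <= 2 ^ w ->
  let e := (i + (2 ^ w - lo)) mod 2 ^ w in
  eqb (Nat.testbit u e) b && (e <? h) = half_true lo h u (i, b).
Proof.
  intros Hi Hlo. unfold half_true. cbn [fst snd].
  destruct (Nat.leb_spec lo i) as [H|H].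
  - replace ((i + (2 ^ w - lo)) mod 2 ^ w) with (i - lo)
      by (symmetry; apply eval_sub; lia).
    cbn [andb]. now rewrite andb_comm.
  - rewrite Nat.mod_small by lia. cbn zeta.
    rewrite (proj2 (Nat.ltb_ge _ _)) by lia. apply andb_false_r.
Qed.

Lemma runs_literal (w d : nat) (l : literal) (pre post out : list nat)
    (xlen o u k j s' n m lo h pad : nat) (s : bool) :
  s' = Nat.b2n s ->
  1 < 2 ^ w -> u < 2 ^ w -> lo + h <= 2 ^ w -> S j < 2 ^ w ->
  encode_literal l < 2 ^ w -> d + length pre + 1 < 2 ^ w ->
  let x := pre ++ encode_literal l :: post in
  runs w 16 literal_step
    (st (frame xlen o (d + length pre) u k (S j) s' n m lo h d pad) (layout d out x))
    (st (frame xlen o (d + length pre + 1) u k j (Nat.b2n (s || half_true lo h u l)) n m lo h d pad)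
        (layout d out x)).
Proof.
  intros -> Hw Hu Hlo Hj Hl Hpre x. destruct l as [i b]. unfold encode_literal in *.
  cbn [fst snd] in *. set (e := (i + (2 ^ w - lo)) mod 2 ^ w).
  change (if b then 1 else 0) with (Nat.b2n b) in *.
  assert (Hb : Nat.b2n b < 2) by (destruct b; simpl; lia).
  unfold literal_step, frame. cbn [block fold_right].
  op j. { rewrite eval_sub; lia. }
  read (2 * i + Nat.b2n b). { apply layout_read. }
  op (d + length pre + 1). { apply eval_add; lia. }
  op (Nat.b2n b).
  { rewrite eval_and_1 by assumption.
    rewrite Nat.add_comm, Nat.mul_comm, Nat.Div0.mod_add. now apply Nat.mod_small. }
  op i.
  { rewrite eval_shiftr by lia. change (2 ^ 1) with 2.
    rewrite Nat.add_comm, Nat.mul_comm, Nat.div_add by lia.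
    rewrite (Nat.div_small _ _ Hb). reflexivity. }
  op e. { reflexivity. }
  op (Nat.b2n (e <? h)). { now apply eval_lt. }
  op (u / 2 ^ e). { now apply eval_shiftr. }
  op (Nat.b2n (Nat.testbit u e)). { rewrite Nat.testbit_spec'. now apply eval_and_1. }
  op (Nat.b2n (eqb (Nat.testbit u e) b)).
  { rewrite eval_eq by assumption. destruct (Nat.testbit u e), b; reflexivity. }
  op (Nat.b2n (half_true lo h u (i, b))).
  { rewrite eval_and_b2n by assumption. f_equal. apply half_true_wrap; lia. }
  op (Nat.b2n (s || half_true lo h u (i, b))). { now apply eval_or_b2n. }
  const. const. const.
  apply runs_skip; [reflexivity|lia].
Qed.

Lemma runs_literals (w d : nat) (C : clause) (pre post out : list nat)
    (xlen o u k n m lo h pad : nat) (s : bool) :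
  1 < 2 ^ w -> u < 2 ^ w -> lo + h <= 2 ^ w ->
  Forall (fun v => v < 2 ^ w) (map encode_literal C) ->
  d + length pre + length C < 2 ^ w ->
  let x := pre ++ map encode_literal C ++ post in
  runs w (17 * length C + 1) (While 5 literal_step)
    (st (frame xlen o (d + length pre) u k (length C) (Nat.b2n s) n m lo h d pad)
        (layout d out x))
    (st (frame xlen o (d + length pre + length C) u k 0 (Nat.b2n (s || half_sat lo h u C))
           n m lo h d pad)
        (layout d out x)).
Proof.
  intros Hw Hu Hlo. revert pre s. induction C as [|l C IH]; intros pre s HC Hlen x.
  - apply runs_while_end; [reflexivity| |lia].
    cbn. rewrite orb_false_r, Nat.add_0_r. reflexivity.
  - cbn [map] in HC. inversion HC as [|v vs Hl HC']; subst. cbn [length] in *.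
    eapply runs_while_step; [discriminate| | |].
    + unfold x. apply runs_literal with (s := s); auto; lia.
    + lia.
    + specialize (IH (pre ++ [encode_literal l]) (s || half_true lo h u l) HC').
      rewrite length_app in IH. cbn [length] in IH. rewrite !Nat.add_assoc in IH.
      rewrite <- !app_assoc in IH. cbn [app] in IH.
      replace (d + length pre + S (length C)) with (d + length pre + 1 + length C) by lia.
      unfold half_sat in *. cbn [existsb]. rewrite orb_assoc.
      eapply runs_weaken; [apply IH; lia|lia].
Qed.

Definition emit (cs : list nat) : program :=
  fold_right (fun c q => Seq (Const 9 c) (Seq (Write 1 9) (Seq (Op Add 1 1 10) q)))
    (block [Const 9 0]) cs.

Lemma runs_emit (w d : nat) (cs out x : list nat)
    (xlen i u k j s n m lo h pad : nat) :
  length (out ++ cs) <= d -> d < 2 ^ w -> Forall (fun c => c < 2 ^ w) cs ->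
  runs w (3 * length cs + 2) (emit cs)
    (st (frame xlen (length out) i u k j s n m lo h d pad) (layout d out x))
    (st (frame xlen (length (out ++ cs)) i u k j s n m lo h d pad) (layout d (out ++ cs) x)).
Proof.
  intros Hlen Hd Hcs.
  enough (H : forall v0, runs w (3 * length cs + 2) (emit cs)
    (st [xlen; length out; i; u; k; j; s; 0; 0; v0; 1; n; m; lo; h; d; pad] (layout d out x))
    (st (frame xlen (length (out ++ cs)) i u k j s n m lo h d pad) (layout d (out ++ cs) x)))
    by apply H.
  unfold frame. revert out Hlen. induction Hcs as [|c cs Hc Hcs IH]; intros out Hlen v0.
  - cbn [emit fold_right block]. const. rewrite app_nil_r. apply runs_skip; [reflexivity|lia].
  - rewrite length_app in Hlen. cbn [length] in Hlen.
    cbn [emit fold_right length]. const.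
    write (layout d (out ++ [c]) x). { apply layout_emit; lia. }
    op (length (out ++ [c])). { rewrite length_app. cbn [length]; apply eval_add; lia. }
    replace (out ++ c :: cs) with ((out ++ [c]) ++ cs) by now rewrite <- app_assoc.
    eapply runs_weaken; [apply IH|lia].
    rewrite !length_app; cbn [length]; lia.
Qed.

Definition emits (w d : nat) (em : program) (tok : bool -> list nat) : Prop :=
  forall (out x : list nat) (xlen i u k j n m lo h pad : nat) (s : bool),
  length (out ++ tok s) <= d ->
  runs w 40 em
    (st (frame xlen (length out) i u k j (Nat.b2n s) n m lo h d pad) (layout d out x))
    (st (frame xlen (length (out ++ tok s)) i u k j 0 n m lo h d pad)
        (layout d (out ++ tok s) x)).

Definition clause_step (em : program) : program := block
  [ Op Sub 4 4 10; Read 5 2; Op Add 2 2 10; While 5 literal_step; em ].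

Definition clause_tokens (C : clause) : list nat := length C :: map encode_literal C.

Lemma runs_clause (w d : nat) (em : program) (tok : bool -> list nat) (C : clause)
    (pre post out : list nat) (xlen u k n m lo h pad : nat) :
  emits w d em tok ->
  1 < 2 ^ w -> u < 2 ^ w -> lo + h <= 2 ^ w -> S k < 2 ^ w ->
  Forall (fun v => v < 2 ^ w) (clause_tokens C) ->
  d + length pre + length (clause_tokens C) < 2 ^ w ->
  length (out ++ tok (half_sat lo h u C)) <= d ->
  let x := pre ++ clause_tokens C ++ post in
  let out' := out ++ tok (half_sat lo h u C) in
  runs w (17 * length C + 45) (clause_step em)
    (st (frame xlen (length out) (d + length pre) u (S k) 0 0 n m lo h d pad) (layout d out x))
    (st (frame xlen (length out') (d + length pre + length (clause_tokens C)) u k 0 0 n m lo h d pad)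
        (layout d out' x)).
Proof.
  intros Hem Hw Hu Hlo Hk HC Hlen Hout x out'.
  unfold clause_tokens in HC, Hlen |- *. cbn [length] in Hlen |- *. rewrite length_map in *.
  inversion HC as [|v vs Hv HC']; subst.
  unfold clause_step, frame. cbn [block fold_right].
  op k. { rewrite eval_sub; lia. }
  read (length C). { apply layout_read. }
  op (d + length pre + 1). { apply eval_add; lia. }
  pose proof (runs_literals w d C (pre ++ [length C]) post out xlen (length out) u k n m lo h pad
    false Hw Hu Hlo HC') as Hlits.
  rewrite length_app in Hlits. cbn [length] in Hlits. rewrite Nat.add_assoc in Hlits.
  rewrite <- app_assoc in Hlits. cbn [app orb Nat.b2n] in Hlits.
  eapply runs_seq; [apply Hlits; lia|lia|].
  replace (d + length pre + 1 + length C) with (d + length pre + S (length C)) by lia.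
  eapply runs_seq; [apply Hem; assumption|lia|].
  apply runs_skip; [reflexivity|lia].
Qed.

Lemma runs_clauses (w d : nat) (em : program) (tok : bool -> list nat) (cs : list clause)
    (pre out : list nat) (xlen u n m lo h pad : nat) :
  emits w d em tok ->
  1 < 2 ^ w -> u < 2 ^ w -> lo + h <= 2 ^ w -> length cs < 2 ^ w ->
  Forall (fun v => v < 2 ^ w) (flat_map clause_tokens cs) ->
  d + length pre + length (flat_map clause_tokens cs) < 2 ^ w ->
  let x := pre ++ flat_map clause_tokens cs in
  let out' := out ++ flat_map tok (half_vector lo h cs u) in
  length out' <= d ->
  runs w (46 * length (flat_map clause_tokens cs) + 1) (While 4 (clause_step em))
    (st (frame xlen (length out) (d + length pre) u (length cs) 0 0 n m lo h d pad)
        (layout d out x))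
    (st (frame xlen (length out') (d + length pre + length (flat_map clause_tokens cs))
           u 0 0 0 n m lo h d pad) (layout d out' x)).
Proof.
  intros Hem Hw Hu Hlo. revert pre out.
  induction cs as [|C cs IH]; intros pre out Hk Hcs Hlen x out' Hout.
  - apply runs_while_end; [reflexivity| |lia].
    unfold out'. cbn. rewrite app_nil_r, Nat.add_0_r. reflexivity.
  - cbn [flat_map half_vector map] in *. rewrite length_app in Hlen |- *.
    apply Forall_app in Hcs as [HC Hcs]. cbn [length] in *.
    unfold out' in Hout |- *. rewrite app_assoc in Hout |- *.
    assert (Hout1 : length (out ++ tok (half_sat lo h u C)) <= d)
      by (rewrite length_app in Hout; lia).
    eapply runs_while_step; [discriminate| | |].
    + apply (runs_clause w d em tok C pre (flat_map clause_tokens cs)); auto; lia.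
    + unfold clause_tokens at 1. cbn [length]. rewrite length_map. lia.
    + specialize (IH (pre ++ clause_tokens C) (out ++ tok (half_sat lo h u C))).
      rewrite (length_app pre), !Nat.add_assoc in IH. rewrite Nat.add_assoc in Hlen |- *.
      unfold x. rewrite (app_assoc pre). unfold half_vector in IH.
      eapply runs_weaken; [apply IH; auto; lia|].
      unfold clause_tokens at 2. cbn [length]. rewrite length_map. lia.
Qed.

Definition vector_step (hd : list nat) (em : program) (tl : list nat) : program := block
  [ Op Sub 3 3 10; Op Add 2 15 10; Op Add 2 2 10; Op Add 4 12 9;
    emit hd; While 4 (clause_step em); emit tl; Const 2 0 ].

Definition vector_tokens (hd : list nat) (tok : bool -> list nat) (tl : list nat) (a : list bool)
  : list nat := hd ++ flat_map tok a ++ tl.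

Lemma runs_vectors (w d : nat) (hd tl : list nat) (em : program) (tok : bool -> list nat)
    (cs : list clause) (a0 a1 : nat) (out : list nat) (xlen u n lo h pad : nat) :
  emits w d em tok ->
  1 < 2 ^ w -> u < 2 ^ w -> lo + h <= 2 ^ w -> length cs < 2 ^ w ->
  Forall (fun v => v < 2 ^ w) (flat_map clause_tokens cs) ->
  Forall (fun v => v < 2 ^ w) hd -> Forall (fun v => v < 2 ^ w) tl ->
  let x := a0 :: a1 :: flat_map clause_tokens cs in
  d + length x < 2 ^ w ->
  let out' := out ++ flat_map (vector_tokens hd tok tl) (map (half_vector lo h cs) (down u)) in
  length out' <= d ->
  runs w (u * (46 * length x + 3 * length hd + 3 * length tl) + 1) (While 3 (vector_step hd em tl))
    (st (frame xlen (length out) 0 u 0 0 0 n (length cs) lo h d pad) (layout d out x))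
    (st (frame xlen (length out') 0 0 0 0 0 n (length cs) lo h d pad) (layout d out' x)).
Proof.
  intros Hem Hw Hu Hlo Hk Hcs Hhd Htl x Hx. revert out.
  induction u as [|u IH]; intros out out' Hout.
  - apply runs_while_end; [reflexivity| |lia].
    unfold out'. cbn. rewrite app_nil_r. reflexivity.
  - unfold out' in Hout |- *. cbn [down map flat_map] in Hout |- *.
    set (tu := vector_tokens hd tok tl (half_vector lo h cs u)) in *.
    rewrite app_assoc in Hout |- *.
    assert (Hout1 : length (out ++ tu) <= d) by (rewrite length_app in Hout; lia).
    unfold tu, vector_tokens in Hout1. rewrite !app_assoc in Hout1.
    assert (Hout2 : length ((out ++ hd) ++ flat_map tok (half_vector lo h cs u)) <= d)
      by (rewrite length_app in Hout1; lia).
    assert (Hout3 : length (out ++ hd) <= d) by (rewrite length_app in Hout2; lia).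
    unfold x in Hx. cbn [length] in Hx.
    apply (runs_while_step _ _ (46 * length x + 3 * length hd + 3 * length tl - 1) _ _ _ _
      (st (frame xlen (length (out ++ tu)) 0 u 0 0 0 n (length cs) lo h d pad)
          (layout d (out ++ tu) x))).
    + discriminate.
    + unfold vector_step, frame. cbn [block fold_right].
      unfold x. cbn [length].
      op u. { rewrite eval_sub; lia. }
      op (d + 1). { apply eval_add; lia. }
      op (d + 1 + 1). { apply eval_add; lia. }
      op (length cs). { rewrite eval_add; lia. }
      eapply runs_seq; [apply runs_emit; auto; lia|lia|].
      pose proof (runs_clauses w d em tok cs [a0; a1] (out ++ hd)) as Hcl.
      cbn [length app] in Hcl.
      replace (d + 1 + 1) with (d + 2) by lia.
      eapply runs_seq; [apply Hcl; auto; lia|lia|].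
      eapply runs_seq; [apply runs_emit; auto; lia|lia|].
      const. apply runs_skip; [|lia].
      unfold tu, vector_tokens. rewrite !app_assoc. reflexivity.
    + cbn [length] in *. unfold x; cbn [length]. lia.
    + eapply runs_weaken; [apply IH; auto; lia|]. unfold x; cbn [length]. lia.
Qed.

Definition left_flag_tokens (s : bool) : list nat := [0; Nat.b2n s].
Definition right_flag_tokens (s : bool) : list nat := set_tokens (right_set s).

Definition left_flag : program := block
  [ emit [0]; Write 1 6; Op Add 1 1 10; Const 6 0 ].
Definition right_flag : program := block
  [ emit [2; 4; 0; 3; 0; 4; 0; 1; 0]; Op Eq 6 6 9; Write 1 6; Op Add 1 1 10; Const 6 0 ].

Lemma small_tokens (w b : nat) (cs : list nat) :
  b < 2 ^ w -> forallb (fun c => c <=? b) cs = true -> Forall (fun c => c < 2 ^ w) cs.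
Proof.
  intros Hb H. rewrite forallb_forall in H. apply Forall_forall. intros c Hc.
  apply H, Nat.leb_le in Hc. lia.
Qed.

Lemma left_flag_emits (w d : nat) : 5 < 2 ^ w -> d < 2 ^ w -> emits w d left_flag left_flag_tokens.
Proof.
  intros Hw Hd out x xlen i u k j n m lo h pad s Hlen.
  unfold left_flag_tokens in *. change [0; Nat.b2n s] with ([0] ++ [Nat.b2n s]) in *.
  rewrite app_assoc in *. assert (Hlen0 : length (out ++ [0]) < d)
    by (rewrite length_app in Hlen; cbn [length] in Hlen; lia).
  unfold left_flag. cbn [block fold_right].
  eapply runs_seq; [apply runs_emit; auto; [lia|apply (small_tokens w 5); auto]|simpl; lia|].
  cbn [length]. unfold frame.
  write (layout d ((out ++ [0]) ++ [Nat.b2n s]) x). { now apply layout_emit. }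
  op (length ((out ++ [0]) ++ [Nat.b2n s])).
  { rewrite (length_app (out ++ [0])). cbn [length]. apply eval_add; lia. }
  const. apply runs_skip; [reflexivity|lia].
Qed.

Lemma right_flag_emits (w d : nat) : 5 < 2 ^ w -> d < 2 ^ w -> emits w d right_flag right_flag_tokens.
Proof.
  intros Hw Hd out x xlen i u k j n m lo h pad s Hlen.
  replace (right_flag_tokens s) with ([2; 4; 0; 3; 0; 4; 0; 1; 0] ++ [Nat.b2n (negb s)]) in *
    by (destruct s; reflexivity).
  set (pre := [2; 4; 0; 3; 0; 4; 0; 1; 0]) in *.
  rewrite app_assoc in *. assert (Hlen0 : length (out ++ pre) < d)
    by (rewrite length_app in Hlen; cbn [length] in Hlen; lia).
  unfold right_flag. cbn [block fold_right]. fold pre.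
  eapply runs_seq; [apply runs_emit; auto; [lia|apply (small_tokens w 5); auto]|simpl; lia|].
  change (length pre) with 9. unfold frame.
  op (Nat.b2n (negb s)). { rewrite eval_eq by lia. now destruct s. }
  write (layout d ((out ++ pre) ++ [Nat.b2n (negb s)]) x). { now apply layout_emit. }
  op (length ((out ++ pre) ++ [Nat.b2n (negb s)])).
  { rewrite (length_app (out ++ pre)). cbn [length]. apply eval_add; lia. }
  const. apply runs_skip; [reflexivity|lia].
Qed.

Definition pad_step : program := block [Op Sub 4 4 10; emit (set_tokens wild)].

Lemma runs_pad (w d k : nat) (out x : list nat) (xlen u n m lo h pad : nat) :
  5 < 2 ^ w -> d < 2 ^ w -> k < 2 ^ w ->
  let out' := out ++ flat_map set_tokens (repeat wild k) in
  length out' <= d ->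
  runs w (42 * k + 1) (While 4 pad_step)
    (st (frame xlen (length out) 0 u k 0 0 n m lo h d pad) (layout d out x))
    (st (frame xlen (length out') 0 u 0 0 0 n m lo h d pad) (layout d out' x)).
Proof.
  intros Hw Hd. revert out. induction k as [|k IH]; intros out Hk out' Hout.
  - apply runs_while_end; [reflexivity| |lia]. unfold out'. cbn. now rewrite app_nil_r.
  - unfold out' in *. cbn [repeat flat_map] in Hout |- *. rewrite app_assoc in Hout |- *.
    assert (Hout1 : length (out ++ set_tokens wild) <= d)
      by (rewrite length_app in Hout; lia).
    apply (runs_while_step _ _ 41 _ _ _ _
      (st (frame xlen (length (out ++ set_tokens wild)) 0 u k 0 0 n m lo h d pad)
          (layout d (out ++ set_tokens wild) x))); [discriminate| |lia|].
    + unfold pad_step, frame. cbn [block fold_right].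
      op k. { rewrite eval_sub; lia. }
      eapply runs_seq; [apply runs_emit; auto; apply (small_tokens w 5); auto|cbn; lia|].
      apply runs_skip; [reflexivity|cbn; lia].
    + eapply runs_weaken; [apply IH; auto; lia|lia].
Qed.

Definition move_step : program := block
  [ Op Sub 5 5 10; Read 7 5; Op Add 8 15 5; Write 8 7; Const 7 0; Write 5 7; Const 8 0 ].

Lemma runs_move (w d : nat) (l r : list nat) (xlen : nat) :
  length l <= d -> d + length l < 2 ^ w -> 0 < 2 ^ w ->
  runs w (10 * length l + 1) (While 5 move_step)
    (st (frame xlen 0 0 0 0 (length l) 0 0 0 0 0 d 0) (layout d l (repeat 0 (length l) ++ r)))
    (st (frame xlen 0 0 0 0 0 0 0 0 0 0 d 0) (layout d [] (l ++ r))).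
Proof.
  intros Hd Hl Hw. revert r Hd Hl. induction l as [|v l IH] using rev_ind; intros r Hd Hl.
  - apply runs_while_end; [reflexivity|reflexivity|lia].
  - rewrite !length_app in *. cbn [length] in *. rewrite !Nat.add_1_r in *.
    apply (runs_while_step _ _ 8 _ _ _ _
      (st (frame xlen 0 0 0 0 (length l) 0 0 0 0 0 d 0)
          (layout d l (repeat 0 (length l) ++ v :: r)))); [discriminate| |lia|].
    + unfold move_step, frame. cbn [block fold_right].
      op (length l). { rewrite eval_sub; lia. }
      read v. { unfold layout. rewrite (proj2 (Nat.ltb_lt _ _)) by lia. apply nth_middle. }
      op (d + length l). { apply eval_add; lia. }
      write (layout d (l ++ [v]) (repeat 0 (length l) ++ v :: r)).
      { replace (repeat 0 (S (length l)) ++ r) with (repeat 0 (length l) ++ 0 :: r).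
        - rewrite <- (repeat_length 0 (length l)) at 2. apply layout_write.
        - rewrite <- Nat.add_1_r, repeat_app, <- app_assoc. reflexivity. }
      const.
      write (layout d l (repeat 0 (length l) ++ v :: r)). { apply layout_erase; lia. }
      const. apply runs_skip; [reflexivity|lia].
    + rewrite <- app_assoc. eapply runs_weaken; [apply IH; lia|lia].
Qed.

Definition erase_step : program := block
  [ Op Sub 5 5 10; Op Add 8 15 5; Write 8 9; Const 8 0 ].

Lemma runs_erase (w d k : nat) (l out : list nat) (xlen o n m lo h pad : nat) :
  d + length l < 2 ^ w ->
  runs w (10 * length l + 1) (While 5 erase_step)
    (st (frame xlen o 0 0 0 (length l) 0 n m lo h d pad) (layout d out (l ++ repeat 0 k)))
    (st (frame xlen o 0 0 0 0 0 n m lo h d pad) (layout d out (repeat 0 (length l + k)))).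
Proof.
  revert k. induction l as [|v l IH] using rev_ind; intros k Hl.
  - apply runs_while_end; [reflexivity|reflexivity|lia].
  - rewrite !length_app in *. cbn [length] in *. rewrite !Nat.add_1_r in *.
    apply (runs_while_step _ _ 8 _ _ _ _
      (st (frame xlen o 0 0 0 (length l) 0 n m lo h d pad)
          (layout d out (l ++ repeat 0 (S k))))); [discriminate| |lia|].
    + unfold erase_step, frame. cbn [block fold_right].
      op (length l). { rewrite eval_sub; lia. }
      op (d + length l). { apply eval_add; lia. }
      write (layout d out (l ++ repeat 0 (S k))).
      { rewrite <- app_assoc. apply layout_write. }
      const. apply runs_skip; [reflexivity|lia].
    + replace (S (length l) + k) with (length l + S k) by lia.
      eapply runs_weaken; [apply IH; lia|lia].
Qed.

(** The address [d = 2 ^ (w - 1) - 1] is computed as [(0 - 1) / 2], so it needs no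
    knowledge of [w]. *)
Definition prepare : program := block
  [ Const 10 1; Op Sub 15 9 10; Op ShiftR 15 15 10;
    Op Add 5 0 9; While 5 move_step;
    Read 14 15; Op Add 14 14 10; Op ShiftR 14 14 10;
    Op Add 8 15 10; Read 12 8; Op ShiftL 11 10 14;
    Const 8 3; Op Add 8 12 8; Op Mul 16 11 8; Const 8 0 ].

Lemma initial_st (x : list nat) :
  initial x = st (length x :: repeat 0 16) (fun i => nth i x 0).
Proof.
  unfold initial, st. f_equal. apply functional_extensionality.
  intros [|i]; [reflexivity|]. unfold update. cbn [Nat.eqb nth].
  now rewrite nth_repeat.
Qed.

Lemma layout_zeros (d k : nat) (x : list nat) :
  length x <= d -> layout d x (repeat 0 k) = fun i => nth i x 0.
Proof.
  intro H. apply functional_extensionality. intro i. unfold layout.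
  destruct (Nat.ltb_spec i d); [reflexivity|].
  rewrite nth_repeat, nth_overflow; [reflexivity|lia].
Qed.

Lemma runs_prepare (w d n m h : nat) (rest : list nat) :
  let x := n :: m :: rest in
  2 * d + 2 = 2 ^ w -> h = (n + 1) / 2 -> 5 < d -> n + 1 < 2 ^ w ->
  length x <= d -> 2 ^ h * (m + 3) <= d ->
  runs w (10 * length x + 17) prepare (initial x)
    (st (frame (length x) 0 0 0 0 0 0 (2 ^ h) m 0 h d (2 ^ h * (m + 3))) (layout d [] x)).
Proof.
  intros x Hd Hh Hd5 Hn Hx Hpad. rewrite initial_st. cbn [repeat].
  assert (Hpos : 2 ^ h <> 0) by now apply Nat.pow_nonzero.
  unfold prepare. cbn [block fold_right].
  const.
  op (2 ^ w - 1). { apply Nat.mod_small; lia. }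
  op d.
  { rewrite eval_shiftr by lia. change (2 ^ 1) with 2.
    replace (2 ^ w - 1) with (1 + d * 2) by lia. now rewrite Nat.div_add by lia. }
  op (length x). { rewrite eval_add; lia. }
  eapply runs_seq.
  { rewrite <- (layout_zeros d (length x) x) by assumption.
    rewrite <- (app_nil_r (repeat 0 (length x))). apply (runs_move w d x []); lia. }
  { lia. }
  rewrite app_nil_r. unfold frame.
  read n. { rewrite <- (Nat.add_0_r d) at 2. apply (layout_read d [] []). }
  op (n + 1). { apply eval_add; lia. }
  op h. { rewrite eval_shiftr by lia. now rewrite Hh. }
  op (d + 1). { apply eval_add; lia. }
  read m. { apply (layout_read d [] [n]). }
  op (2 ^ h). { apply eval_shiftl_1; nia. }
  const.
  op (m + 3). { apply eval_add; nia. }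
  op (2 ^ h * (m + 3)). { apply eval_mul; lia. }
  const. apply runs_skip; [reflexivity|lia].
Qed.

(** The literal lists are the tokens of [x^+ #] and [y^+]. *)
Definition emit_left : program := block
  [ emit [1]; Write 1 16; Op Add 1 1 10; Op Add 3 11 9;
    While 3 (vector_step [3; 0; 3; 0; 2] left_flag [3; 0; 4]) ].

Lemma runs_emit_left (w d n h : nat) (cs : list clause) :
  let m := length cs in
  let x := n :: m :: flat_map clause_tokens cs in
  let out := encode_regex (left_expr (half_vectors 0 h cs)) in
  let pad := 2 ^ h * (m + 3) in
  2 * d + 2 = 2 ^ w -> 5 < d -> h <= d -> length x <= d -> m <= d -> 2 ^ h <= d ->
  Forall (fun v => v < 2 ^ w) x -> length out <= d ->
  runs w (2 ^ h * (46 * length x + 24) + 10) emit_left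
    (st (frame (length x) 0 0 0 0 0 0 (2 ^ h) m 0 h d pad) (layout d [] x))
    (st (frame (length x) (length out) 0 0 0 0 0 (2 ^ h) m 0 h d pad) (layout d out x)).
Proof.
  intros m x out pad Hd Hd5 Hhd Hx Hm HN Hfx.
  assert (Eout : out = (([] ++ [1]) ++ [pad]) ++ flat_map
     (vector_tokens [3; 0; 3; 0; 2] left_flag_tokens [3; 0; 4]) (half_vectors 0 h cs)).
  { unfold out. rewrite (encode_left_expr m) by apply length_in_half_vectors.
    now rewrite length_half_vectors. }
  rewrite Eout. clear out Eout. intro Hout.
  assert (Hout2 : length (([] ++ [1]) ++ [pad]) <= d) by (cbn; lia).
  inversion Hfx as [|? ? _ Hfx']; subst. inversion Hfx' as [|? ? _ Hfcs]; subst.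
  unfold emit_left. cbn [block fold_right].
  eapply runs_seq; [apply (runs_emit w d [1] [] x); [cbn; lia|lia|apply (small_tokens w 1); auto; lia]|cbn; lia|].
  unfold frame. cbn [length].
  write (layout d (([] ++ [1]) ++ [pad]) x). { apply layout_emit; cbn; lia. }
  op (length (([] ++ [1]) ++ [pad])). { apply eval_add; cbn; lia. }
  op (2 ^ h). { rewrite eval_add; lia. }
  eapply (runs_seq _ _ (2 ^ h * (46 * length x + 24) + 1)).
  { eapply runs_weaken.
    apply (runs_vectors w d [3; 0; 3; 0; 2] [3; 0; 4] left_flag left_flag_tokens cs n m); auto;
      try lia.
    - apply left_flag_emits; lia.
    - apply (small_tokens w 5); auto; lia.
    - apply (small_tokens w 5); auto; lia.
    - unfold x, m in *; lia.
    - unfold x; cbn [length]; apply Nat.eq_le_incl; ring. }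
  { lia. }
  apply runs_skip; [reflexivity|lia].
Qed.

(** The token [1] opens a concatenation; [2; 1; 0; 3] and [2; 1; 0; 4] are the guards
    [{x}] and [{y}], and the list in the loop is [{#,x,y}]. *)
Definition emit_right : program := block
  [ emit [1]; Op Add 8 12 10; Op Mul 8 11 8; Op Add 8 8 10; Op Add 8 8 10;
    Op Add 8 8 16; Op Add 8 8 16; Write 1 8; Op Add 1 1 10; Const 8 0;
    Op Add 4 16 9; While 4 pad_step; emit [2; 1; 0; 3];
    Op Add 13 14 9; Op Add 3 11 9;
    While 3 (vector_step [2; 3; 0; 2; 0; 3; 0; 4] right_flag []);
    emit [2; 1; 0; 4]; Op Add 4 16 9; While 4 pad_step ].

Lemma flat_map_right_gadgets (bvs : list (list bool)) :
  flat_map set_tokens (flat_map right_gadget bvs) =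
  flat_map (vector_tokens [2; 3; 0; 2; 0; 3; 0; 4] right_flag_tokens []) bvs.
Proof.
  rewrite flat_map_flat_map. apply flat_map_ext. intro b.
  unfold right_gadget, vector_tokens, right_flag_tokens. cbn [flat_map].
  now rewrite flat_map_map, app_nil_r.
Qed.

Lemma runs_emit_right (w d n h : nat) (cs : list clause) (out0 : list nat) :
  let m := length cs in
  let x := n :: m :: flat_map clause_tokens cs in
  let pad := 2 ^ h * (m + 3) in
  let out := out0 ++ encode_regex (right_expr pad (half_vectors h h cs)) in
  2 * d + 2 = 2 ^ w -> 5 < d -> h <= d -> length x <= d -> m <= d -> 2 ^ h <= d ->
  pad + pad + 2 + 2 ^ h * (m + 1) <= d ->
  Forall (fun v => v < 2 ^ w) x -> length out <= d ->
  runs w (2 ^ h * (46 * length x + 24) + 84 * pad + 60) emit_right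
    (st (frame (length x) (length out0) 0 0 0 0 0 (2 ^ h) m 0 h d pad) (layout d out0 x))
    (st (frame (length x) (length out) 0 0 0 0 0 (2 ^ h) m h h d pad) (layout d out x)).
Proof.
  intros m x pad out Hd Hd5 Hhd Hx Hm HN Hcnt Hfx.
  set (cnt := pad + pad + 2 + 2 ^ h * (m + 1)) in *.
  set (P := flat_map set_tokens (repeat wild pad)).
  set (V := flat_map (vector_tokens [2; 3; 0; 2; 0; 3; 0; 4] right_flag_tokens [])
              (half_vectors h h cs)).
  assert (Eout : out = (((((out0 ++ [1]) ++ [cnt]) ++ P) ++ [2; 1; 0; 3]) ++ V) ++ [2; 1; 0; 4] ++ P).
  { unfold out. rewrite encode_right_expr.
    rewrite (length_right_sets m) by apply length_in_half_vectors.
    rewrite length_half_vectors. fold cnt. unfold right_sets.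
    rewrite flat_map_app. cbn [flat_map]. rewrite flat_map_app. cbn [flat_map].
    rewrite flat_map_right_gadgets. fold P V.
    rewrite <- !app_assoc. reflexivity. }
  rewrite (app_assoc _ [2; 1; 0; 4]) in Eout. rewrite Eout. clear out Eout. intro Hout.
  set (o1 := out0 ++ [1]) in *. set (o2 := o1 ++ [cnt]) in *. set (o3 := o2 ++ P) in *.
  set (o4 := o3 ++ [2; 1; 0; 3]) in *. set (o5 := o4 ++ V) in *.
  set (o6 := o5 ++ [2; 1; 0; 4]) in *. set (o7 := o6 ++ P) in *.
  assert (H6 : length o6 <= d) by (unfold o7 in Hout; rewrite length_app in Hout; lia).
  assert (H5 : length o5 <= d) by (unfold o6 in H6; rewrite length_app in H6; lia).
  assert (H4 : length o4 <= d) by (unfold o5 in H5; rewrite length_app in H5; lia).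
  assert (H3 : length o3 <= d) by (unfold o4 in H4; rewrite length_app in H4; lia).
  assert (H2 : length o2 <= d) by (unfold o3 in H3; rewrite length_app in H3; lia).
  assert (E2 : length o1 + 1 = length o2) by (unfold o2; now rewrite length_app).
  inversion Hfx as [|? ? _ Hfx']; subst. inversion Hfx' as [|? ? _ Hfcs]; subst.
  assert (Hsmall : forall l, forallb (fun c => c <=? 5) l = true ->
    Forall (fun v => v < 2 ^ w) l) by (intros l Hl; apply (small_tokens w 5); auto; lia).
  unfold emit_right. cbn [block fold_right].
  eapply runs_seq; [apply (runs_emit w d [1] out0 x); [fold o1; lia|lia|auto]|cbn; lia|].
  fold o1. unfold frame. cbn [length].
  op (m + 1). { apply eval_add; lia. }
  op (2 ^ h * (m + 1)). { apply eval_mul; lia. }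
  op (2 ^ h * (m + 1) + 1). { apply eval_add; lia. }
  op (2 ^ h * (m + 1) + 1 + 1). { apply eval_add; lia. }
  op (2 ^ h * (m + 1) + 1 + 1 + pad). { apply eval_add; lia. }
  op cnt. { rewrite eval_add; lia. }
  write (layout d o2 x). { apply layout_emit; lia. }
  op (length o2). { rewrite eval_add; lia. }
  const.
  op pad. { rewrite eval_add; lia. }
  eapply runs_seq; [apply (runs_pad w d pad o2 x); auto; lia|lia|]. fold P o3.
  eapply runs_seq; [apply runs_emit; auto; lia|cbn; lia|]. fold o4. unfold frame. cbn [length].
  op h. { rewrite eval_add; lia. }
  op (2 ^ h). { rewrite eval_add; lia. }
  eapply (runs_seq _ _ (2 ^ h * (46 * length x + 24) + 1)).
  { eapply runs_weaken.
    apply (runs_vectors w d [2; 3; 0; 2; 0; 3; 0; 4] [] right_flag right_flag_tokens cs n m); auto;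
      try lia.
    - apply right_flag_emits; lia.
    - unfold x, m in *; lia.
    - unfold x; cbn [length]; apply Nat.eq_le_incl; ring. }
  { lia. }
  change (flat_map (vector_tokens [2; 3; 0; 2; 0; 3; 0; 4] right_flag_tokens [])
    (map (half_vector h h cs) (down (2 ^ h)))) with V. fold o5.
  eapply runs_seq; [apply runs_emit; auto; lia|cbn [length]; lia|]. fold o6. unfold frame. cbn [length].
  op pad. { rewrite eval_add; lia. }
  eapply runs_seq; [apply (runs_pad w d pad o6 x); auto; lia|lia|].
  apply runs_skip; [reflexivity|lia].
Qed.

(** The intersection algorithm has to be started on a machine whose registers and
    memory are zero apart from its input. *)
Definition finish : program := block
  [ Op Add 5 0 9; While 5 erase_step; Op Add 0 1 9; Const 1 0; Const 10 0; Const 11 0;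
    Const 12 0; Const 13 0; Const 14 0; Const 15 0; Const 16 0 ].

Lemma runs_finish (w d : nat) (out x : list nat) (n m lo h pad : nat) :
  2 * d + 2 = 2 ^ w -> length x <= d -> length out <= d ->
  runs w (10 * length x + 12) finish
    (st (frame (length x) (length out) 0 0 0 0 0 n m lo h d pad) (layout d out x)) (initial out).
Proof.
  intros Hd Hx Hout. unfold finish, frame. cbn [block fold_right].
  op (length x). { rewrite eval_add; lia. }
  pose proof (runs_erase w d 0 x out (length x)) as Herase.
  cbn [repeat] in Herase. rewrite app_nil_r in Herase.
  eapply runs_seq; [apply Herase; lia|lia|].
  unfold frame. op (length out). { rewrite eval_add; lia. }
  const. const. const. const. const. const. const. const.
  apply runs_skip; [|lia].
  rewrite initial_st, layout_zeros by assumption. reflexivity.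
Qed.

Definition reduction : program := block [prepare; emit_left; emit_right; finish].

Definition reduce (F : cnf) : regex * regex :=
  let h := (num_vars F + 1) / 2 in
  let m := length (clauses F) in
  (left_expr (half_vectors 0 h (clauses F)),
   right_expr (2 ^ h * (m + 3)) (half_vectors h h (clauses F))).

Lemma encode_cnf_tokens (F : cnf) :
  encode_cnf F = num_vars F :: length (clauses F) :: flat_map clause_tokens (clauses F).
Proof. unfold encode_cnf. now rewrite flat_map_concat_map. Qed.

Lemma length_flat_map_ge {X Y : Type} (f : X -> list Y) (n : nat) (l : list X) :
  (forall x, In x l -> n <= length (f x)) -> length l * n <= length (flat_map f l).
Proof.
  intro H. induction l as [|x l IH]; [reflexivity|].
  simpl. rewrite length_app. pose proof (H x (or_introl eq_refl)).
  assert (length l * n <= length (flat_map f l)) by (apply IH; intros y Hy; apply H; now right).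
  lia.
Qed.

Lemma runs_reduction (w : nat) (F : cnf) :
  let x := encode_cnf F in
  let AB := reduce F in
  let out := encode_regex (fst AB) ++ encode_regex (snd AB) in
  let h := (num_vars F + 1) / 2 in
  1 <= w -> Forall (fun v => v < 2 ^ w) x ->
  2 * length x + 2 <= 2 ^ w -> 2 * length out + 2 <= 2 ^ w ->
  runs w (2 ^ h * (300 * length x + 400)) reduction (initial x) (initial out).
Proof.
  intros x AB out h Hw Hfx Hx Hout.
  set (cs := clauses F) in *. set (m := length cs).
  assert (Hd : 2 * (2 ^ (w - 1) - 1) + 2 = 2 ^ w).
  { destruct w as [|w]; [lia|]. rewrite Nat.pow_succ_r'. simpl Nat.sub. rewrite Nat.sub_0_r.
    pose proof (Nat.pow_nonzero 2 w). lia. }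
  set (d := 2 ^ (w - 1) - 1) in *.
  set (pad := 2 ^ h * (m + 3)).
  set (oA := encode_regex (left_expr (half_vectors 0 h cs))).
  assert (Eout : out = oA ++ encode_regex (right_expr pad (half_vectors h h cs))) by reflexivity.
  assert (Hcnt : pad + pad + 2 + 2 ^ h * (m + 1) + 2 <= length out).
  { rewrite Eout, encode_right_expr, !length_app.
    pose proof (length_flat_map_ge set_tokens 1 (right_sets pad (half_vectors h h cs))) as Hge.
    rewrite (length_right_sets m) in * by apply length_in_half_vectors.
    rewrite length_half_vectors in *.
    assert (length (flat_map set_tokens (right_sets pad (half_vectors h h cs)))
      >= pad + pad + 2 + 2 ^ h * (m + 1)).
    { unfold ge. etransitivity; [|apply Hge]; [lia|]. intros S _. simpl; lia. }
    cbn [length]. lia. }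
  assert (HN : 2 ^ h <> 0) by now apply Nat.pow_nonzero.
  assert (Hh : h < 2 ^ h) by (apply Nat.pow_gt_lin_r; lia).
  assert (Hpad : 2 ^ h * 3 <= pad) by (unfold pad; nia).
  assert (Hmpad : m <= pad) by (unfold pad; nia).
  assert (Hn : num_vars F + 1 <= 2 * h + 1).
  { unfold h. pose proof (Nat.div_mod_eq (num_vars F + 1) 2).
    pose proof (Nat.mod_upper_bound (num_vars F + 1) 2). lia. }
  assert (Hx' : length x <= d) by lia.
  assert (Hout' : length out <= d) by lia.
  assert (HoA : length oA <= d) by (rewrite Eout, length_app in Hout'; lia).
  unfold x in *. rewrite encode_cnf_tokens in *. fold cs m in Hfx, Hx' |- *.
  set (y := num_vars F :: m :: flat_map clause_tokens cs) in *.
  assert (Hpady : pad <= 2 ^ h * (length y + 1)).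
  { unfold pad, y. cbn [length]. apply Nat.mul_le_mono_l.
    pose proof (length_flat_map_ge clause_tokens 1 cs) as Hge.
    assert (m * 1 <= length (flat_map clause_tokens cs))
      by (apply Hge; intros C _; simpl; lia). lia. }
  assert (Hy1 : length y <= 2 ^ h * length y) by nia.
  unfold reduction. cbn [block fold_right].
  eapply runs_seq; [apply (runs_prepare w d _ m h); auto; lia|fold y; lia|].
  eapply runs_seq; [apply (runs_emit_left w d (num_vars F) h cs); auto; lia|fold m y; lia|].
  eapply runs_seq; [apply (runs_emit_right w d (num_vars F) h cs oA); auto; lia|fold m y; fold pad; lia|].
  eapply runs_seq; [apply (runs_finish w d out y); auto; lia|fold m y; fold pad; lia|].
  apply runs_skip; [reflexivity|fold m y; fold pad; lia].
Qed.

(** * Running time *)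

Definition literals (n : nat) : list literal :=
  flat_map (fun i => [(i, true); (i, false)]) (down n).

Fixpoint short_clauses (n k : nat) : list clause :=
  match k with
  | O => [[]]
  | S k => [] :: flat_map (fun l => map (cons l) (short_clauses n k)) (literals n)
  end.

Lemma length_short_clauses (n k : nat) : length (short_clauses n k) <= (2 * n + 1) ^ k.
Proof.
  induction k as [|k IH]; [reflexivity|].
  cbn [short_clauses length].
  rewrite (length_flat_map_const _ (length (short_clauses n k)))
    by (intros l _; apply length_map).
  replace (length (literals n)) with (2 * n).
  - rewrite Nat.pow_succ_r'. assert ((2 * n + 1) ^ k <> 0) by (apply Nat.pow_nonzero; lia). nia.
  - unfold literals. rewrite (length_flat_map_const _ 2) by reflexivity.
    rewrite length_down. lia.
Qed.

Lemma in_short_clauses (n k : nat) (C : clause) :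
  length C <= k -> (forall l, In l C -> fst l < n) -> In C (short_clauses n k).
Proof.
  revert C; induction k as [|k IH]; intros [|l C] Hlen HC; simpl in Hlen.
  - now left.
  - lia.
  - now left.
  - right. apply in_flat_map. exists l. split.
    + apply in_flat_map. exists (fst l). split; [apply in_down, HC; now left|].
      destruct l as [i [|]]; simpl; auto.
    + apply in_map, IH; [lia|]. intros l' Hl'. apply HC; now right.
Qed.

Lemma length_encode_kcnf (k : nat) (F : cnf) :
  kcnf k F -> length (encode_cnf F) <= 2 + (k + 1) * (2 * num_vars F + 1) ^ k.
Proof.
  intros [Hnd HF]. rewrite encode_cnf_tokens. cbn [length].
  assert (Hlen : length (flat_map clause_tokens (clauses F)) <= length (clauses F) * (k + 1)).
  { rewrite flat_map_concat_map, length_concat, map_map. apply list_sum_le_const.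
    intros C HC. apply HF in HC as [HC _]. unfold clause_tokens. simpl.
    rewrite length_map. lia. }
  assert (Hcount : length (clauses F) <= (2 * num_vars F + 1) ^ k).
  { etransitivity; [|apply length_short_clauses].
    apply NoDup_incl_length; [assumption|]. intros C HC. apply HF in HC as [HC HV].
    now apply in_short_clauses. }
  nia.
Qed.

Lemma half_vectors_nonempty (lo h : nat) (cs : list clause) : half_vectors lo h cs <> [].
Proof.
  intro H. pose proof (length_half_vectors lo h cs) as HN. rewrite H in HN.
  pose proof (Nat.pow_nonzero 2 h). simpl in HN; lia.
Qed.

Lemma reduce_correct (k : nat) (F : cnf) :
  kcnf k F ->
  (homogeneous OConcat OPlus (fst (reduce F)) /\ homogeneous OConcat OUnion (snd (reduce F))) /\
  ((exists u, lang (fst (reduce F)) u /\ lang (snd (reduce F)) u) <-> satisfiable F).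
Proof.
  intros [_ HF]. unfold reduce. cbn zeta.
  set (h := (num_vars F + 1) / 2). cbn [fst snd].
  split.
  - split; [apply left_expr_homogeneous, half_vectors_nonempty|apply right_expr_homogeneous].
  - rewrite (satisfiable_iff_halves F h).
    + rewrite <- (length_half_vectors 0 h (clauses F)).
      apply intersection_nonempty_iff; apply length_in_half_vectors.
    + intros C l HC Hl. apply HF in HC as [_ HC]. apply HC in Hl.
      unfold h. pose proof (Nat.div_mod_eq (num_vars F + 1) 2).
      pose proof (Nat.mod_upper_bound (num_vars F + 1) 2). lia.
Qed.

Lemma length_set_tokens (S : list letter) : length (set_tokens S) = 2 + length S * 2.
Proof.
  unfold set_tokens. cbn [length]. now rewrite (length_flat_map_const _ 2).
Qed.

Lemma reduce_sizes (F : cnf) :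
  let Y := 2 ^ ((num_vars F + 1) / 2) * (length (encode_cnf F) + 3) in
  let A := fst (reduce F) in
  let B := snd (reduce F) in
  1 <= size A <= Y /\ 1 <= size B <= 20 * Y /\
  length (encode_regex A ++ encode_regex B) <= 60 * Y /\
  5 < length (encode_regex A ++ encode_regex B) /\
  Forall (fun v => v <= length (encode_regex A ++ encode_regex B))
    (encode_regex A ++ encode_regex B).
Proof.
  unfold reduce. cbn zeta. cbn [fst snd].
  set (h := (num_vars F + 1) / 2). set (cs := clauses F). set (m := length cs).
  set (avs := half_vectors 0 h cs). set (bvs := half_vectors h h cs).
  set (pad := 2 ^ h * (m + 3)).
  assert (Hm : m <= length (encode_cnf F)).
  { rewrite encode_cnf_tokens. cbn [length]. fold cs.
    pose proof (length_flat_map_ge clause_tokens 1 cs) as Hge.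
    assert (m * 1 <= length (flat_map clause_tokens cs))
      by (apply Hge; intros C _; simpl; lia). lia. }
  set (Y := 2 ^ h * (length (encode_cnf F) + 3)).
  assert (HY : pad <= Y) by (apply Nat.mul_le_mono_l; lia).
  assert (HN : 2 ^ h <> 0) by now apply Nat.pow_nonzero.
  assert (Has : forall a, In a avs -> length a = m) by apply length_in_half_vectors.
  assert (Hbs : forall b, In b bvs -> length b = m) by apply length_in_half_vectors.
  assert (HlA : length avs = 2 ^ h) by apply length_half_vectors.
  assert (HlB : length bvs = 2 ^ h) by apply length_half_vectors.
  assert (HsA : size (left_expr avs) = pad) by (rewrite (size_left_expr m), HlA; auto).
  assert (Hset : length (right_sets pad bvs) = pad + pad + 2 + 2 ^ h * (m + 1))
    by (rewrite (length_right_sets m), HlB; auto).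
  assert (Hpad3 : 3 <= pad) by (unfold pad; nia).
  assert (Hset4 : length (right_sets pad bvs) <= 4 * pad) by (unfold pad in *; nia).
  pose proof (size_right_expr pad bvs) as HsB.
  assert (EA : encode_regex (left_expr avs) = [1; pad] ++ flat_map left_tokens avs)
    by (rewrite (encode_left_expr m), HlA; auto).
  assert (LA : length (encode_regex (left_expr avs)) = 2 + 2 ^ h * (8 + 2 * m)).
  { rewrite EA, length_app, (length_flat_map_const _ (8 + 2 * m)), HlA; [reflexivity|].
    intros a Ha. unfold left_tokens. rewrite !length_app, (length_flat_map_const _ 2) by reflexivity.
    rewrite (Has a Ha). simpl; lia. }
  assert (LB : 2 + length (right_sets pad bvs) <= length (encode_regex (right_expr pad bvs))
               <= 2 + length (right_sets pad bvs) * 12).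
  { rewrite encode_right_expr, length_app. cbn [length]. split.
    - pose proof (length_flat_map_ge set_tokens 1 (right_sets pad bvs)) as Hge.
      assert (length (right_sets pad bvs) * 1 <= length (flat_map set_tokens (right_sets pad bvs)))
        by (apply Hge; intros S _; simpl; lia). lia.
    - rewrite flat_map_concat_map, length_concat, map_map. apply le_n_S, le_n_S.
      apply list_sum_le_const. intros S HS. rewrite length_set_tokens.
      apply length_in_right_sets in HS. lia. }
  assert (L5 : 5 < length (encode_regex (left_expr avs) ++ encode_regex (right_expr pad bvs)))
    by (rewrite length_app; nia).
  split; [lia|]. split; [lia|]. split; [rewrite length_app; unfold pad in *; nia|].
  split; [assumption|].
  set (L := length (encode_regex (left_expr avs) ++ encode_regex (right_expr pad bvs))) in *.
  assert (HL : L = length (encode_regex (left_expr avs)) + length (encode_regex (right_expr pad bvs)))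
    by apply length_app.
  assert (Hle5 : forall l, Forall (fun v => v <= 5) l -> Forall (fun v => v <= L) l).
  { intros l. apply Forall_impl. lia. }
  rewrite Forall_app; split.
  - rewrite EA, Forall_app. split; [constructor; [lia|constructor; [lia|constructor]]|].
    apply Hle5, Forall_flat_map, Forall_forall. intros a _. unfold left_tokens.
    rewrite !Forall_app. split; [repeat constructor|]. split; [|repeat constructor].
    apply Forall_flat_map, Forall_forall. intros s _. destruct s; repeat constructor.
  - rewrite encode_right_expr, Forall_app.
    split; [constructor; [lia|constructor; [lia|constructor]]|].
    apply Hle5, Forall_flat_map, Forall_forall. intros S HS.
    apply length_in_right_sets in HS as [HS1 HS2].
    constructor; [lia|]. constructor; [lia|].
    apply Forall_flat_map. eapply Forall_impl; [|exact HS2].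
    intros c Hc; simpl in Hc. constructor; [lia|]. constructor; [lia|constructor].
Qed.

Local Open Scope R_scope.

Lemma linear_le_exponential (delta : R) :
  0 < delta -> exists Q, 1 <= Q /\ forall n : nat, 2 * INR n + 1 <= Q * Rpower 2 (delta * INR n).
Proof.
  intro Hd. assert (Hln : 0 < ln 2) by (rewrite <- ln_1; apply ln_increasing; lra).
  set (r := delta * ln 2). assert (Hr : 0 < r) by now apply Rmult_lt_0_compat.
  assert (Hir : 0 < / r) by now apply Rinv_0_lt_compat.
  exists (1 + 2 * / r). split; [lra|]. intro n.
  replace (Rpower 2 (delta * INR n)) with (exp (r * INR n))
    by (unfold Rpower, r; f_equal; ring).
  pose proof (pos_INR n) as Hn.
  pose proof (exp_ineq1_le (r * INR n)) as He.
  assert (Hrn : 0 <= r * INR n) by nra.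
  assert (E : INR n = / r * (r * INR n)) by (field; lra).
  assert (H : INR n <= / r * exp (r * INR n)).
  { rewrite E at 1. apply Rmult_le_compat_l; lra. }
  lra.
Qed.

Lemma polynomial_le_exponential (k : nat) (delta : R) :
  0 < delta ->
  exists Q, 1 <= Q /\ forall n : nat, (2 * INR n + 1) ^ k <= Q * Rpower 2 (delta * INR n).
Proof.
  revert delta; induction k as [|k IH]; intros delta Hd.
  - exists 1. split; [lra|]. intro n. rewrite Rmult_1_l. simpl.
    rewrite <- (Rpower_O 2) by lra. apply Rle_Rpower; [lra|].
    pose proof (pos_INR n). nra.
  - destruct (IH (delta / 2)) as (Q & HQ & Hk); [lra|].
    destruct (linear_le_exponential (delta / 2)) as (Q1 & HQ1 & H1); [lra|].
    exists (Q1 * Q). split; [nra|]. intro n.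
    replace (delta * INR n) with (delta / 2 * INR n + delta / 2 * INR n) by field.
    rewrite Rpower_plus. set (E := Rpower 2 (delta / 2 * INR n)) in *.
    replace (Q1 * Q * (E * E)) with ((Q1 * E) * (Q * E)) by ring.
    cbn [pow]. pose proof (pos_INR n).
    apply Rmult_le_compat; [lra|apply pow_le; lra|apply H1|apply Hk].
Qed.

Lemma kcnf_length_subexponential (k : nat) (delta : R) :
  0 < delta ->
  exists Q, 1 <= Q /\ forall F, kcnf k F ->
    INR (length (encode_cnf F) + 3) <= Q * Rpower 2 (delta * INR (num_vars F)).
Proof.
  intro Hd. destruct (polynomial_le_exponential k delta Hd) as (Q & HQ & Hk).
  pose proof (pos_INR k) as Hk0.
  exists (5 + (INR k + 1) * Q). split; [nra|]. intros F HF.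
  pose proof (length_encode_kcnf k F HF) as Hlen.
  specialize (Hk (num_vars F)). set (E := Rpower 2 (delta * INR (num_vars F))) in *.
  assert (HE : 1 <= E).
  { unfold E. rewrite <- (Rpower_O 2) by lra. apply Rle_Rpower; [lra|].
    pose proof (pos_INR (num_vars F)). nra. }
  apply Rle_trans with (INR (5 + (k + 1) * (2 * num_vars F + 1) ^ k)).
  { apply le_INR; lia. }
  rewrite plus_INR, mult_INR, pow_INR, !plus_INR, mult_INR.
  change (INR 5) with (1 + 1 + 1 + 1 + 1). change (INR 2) with (1 + 1). change (INR 1) with 1.
  replace (1 + 1) with 2 by ring. nra.
Qed.

Lemma pow2_half_le (n : nat) :
  INR (2 ^ ((n + 1) / 2)) <= 2 * Rpower 2 (INR n / 2).
Proof.
  rewrite pow_INR. change (INR 2) with (1 + 1). replace (1 + 1) with 2 by ring.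
  rewrite <- Rpower_pow by lra.
  rewrite <- (Rpower_1 2) at 2 by lra. rewrite <- Rpower_plus. apply Rle_Rpower; [lra|].
  assert (H : (2 * ((n + 1) / 2) <= n + 1)%nat) by apply Nat.Div0.mul_div_le.
  apply le_INR in H. rewrite mult_INR, plus_INR in H. change (INR 2) with 2 in H. change (INR 1) with 1 in H. lra.
Qed.

(** With [a = min alpha (1/2)] both the reduction and the calls to the
    intersection algorithm take time [O(2 ^ ((1 - a / 2) n))]: the exponent of
    the latter is [(1 + a / 2) (1 - a) <= 1 - a / 2]. *)
Lemma reduction_costs (k : nat) (alpha a : R) :
  0 < a -> a <= / 2 -> a <= alpha ->
  exists K, 1 <= K /\ forall F, kcnf k F ->
    let T := Rpower 2 ((1 - a / 2) * INR (num_vars F)) in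
    let Y := (2 ^ ((num_vars F + 1) / 2) * (length (encode_cnf F) + 3))%nat in
    INR Y <= K * T /\
    Rpower (INR (size (fst (reduce F))) * INR (size (snd (reduce F)))) (1 - alpha) <= K * T.
Proof.
  intros Ha Ha2 Haa.
  destruct (kcnf_length_subexponential k (a / 4)) as (Q & HQ & HF); [lra|].
  exists (80 * (Q * Q)). split; [nra|]. intros F Hk T Y. specialize (HF F Hk).
  set (n := num_vars F) in *. pose proof (pos_INR n) as Hn.
  set (E := Rpower 2 (a / 4 * INR n)) in *. set (D := Rpower 2 (INR n / 2)).
  assert (HE : 0 < E) by apply exp_pos. assert (HD : 0 < D) by apply exp_pos.
  assert (HT : 0 < T) by apply exp_pos.
  assert (HY : INR Y <= 2 * Q * (D * E)).
  { unfold Y. rewrite mult_INR. replace (2 * Q * (D * E)) with ((2 * D) * (Q * E)) by ring.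
    apply Rmult_le_compat; auto using pos_INR. apply pow2_half_le. }
  assert (HDE : D * E <= T).
  { unfold D, E, T. rewrite <- Rpower_plus. apply Rle_Rpower; [lra|]. nra. }
  split.
  { apply Rle_trans with (1 := HY). apply Rmult_le_compat; nra. }
  destruct (reduce_sizes F) as ((HA1 & HA) & (HB1 & HB) & _). fold n Y in HA, HB.
  apply le_INR in HA1, HA, HB1, HB. rewrite mult_INR in HB.
  replace (INR 20) with 20 in HB by (simpl; ring). change (INR 1) with 1 in HA1, HB1.
  set (sA := INR (size (fst (reduce F)))) in *. set (sB := INR (size (snd (reduce F)))) in *.
  assert (Hs : 1 <= sA * sB) by nra.
  assert (HsY : sA * sB <= 80 * (Q * Q) * Rpower 2 ((1 + a / 2) * INR n)).
  { replace (Rpower 2 ((1 + a / 2) * INR n)) with ((D * E) * (D * E)).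
    2:{ unfold D, E. rewrite <- !Rpower_plus. f_equal. field. }
    set (G := D * E) in *. pose proof (pos_INR Y).
    apply Rle_trans with (INR Y * (20 * INR Y)); [apply Rmult_le_compat; lra|].
    assert (INR Y * INR Y <= (2 * Q * G) * (2 * Q * G)) by (apply Rmult_le_compat; lra).
    lra. }
  apply Rle_trans with (Rpower (sA * sB) (1 - a)).
  { destruct Hs as [Hs|<-]; [apply Rle_Rpower; lra|]. unfold Rpower. rewrite ln_1, !Rmult_0_r. lra. }
  apply Rle_trans with (Rpower (80 * (Q * Q) * Rpower 2 ((1 + a / 2) * INR n)) (1 - a)).
  { apply Rle_Rpower_l; lra. }
  rewrite <- Rpower_mult_distr by (try apply exp_pos; nra).
  rewrite Rpower_mult.
  apply Rmult_le_compat; try (left; apply exp_pos).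
  - rewrite <- (Rpower_1 (80 * (Q * Q))) at 2 by nra. apply Rle_Rpower; nra.
  - apply Rle_Rpower; [lra|]. nra.
Qed.

Lemma pow2_unbounded (K : R) : exists g : nat, K <= 2 ^ g.
Proof.
  destruct (Pow_x_infinity 2) with (b := K) as (g & Hg); [rewrite Rabs_right; lra|].
  exists g. specialize (Hg g (le_n g)). rewrite Rabs_right in Hg; [lra|].
  apply Rle_ge, pow_le; lra.
Qed.

Lemma SAT_solvable_from_intersection (k : nat) (alpha a : R) :
  0 < a -> a <= / 2 -> a <= alpha ->
  solvable_in_time (homogeneous_intersection OConcat OPlus OConcat OUnion)
    (fun AB : regex * regex => Rpower (INR (size (fst AB)) * INR (size (snd AB))) (1 - alpha)) ->
  solvable_in_time (k_SAT k) (fun F => Rpower 2 ((1 - a / 2) * INR (num_vars F))).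
Proof.
  intros Ha Ha2 Haa (p & c & Hp).
  destruct (reduction_costs k alpha a Ha Ha2 Haa) as (K & HK & Hcost).
  destruct (pow2_unbounded (130 * K)) as (g & Hg).
  destruct (INR_unbounded (K * (400 + 61 * INR c))) as (c0 & Hc0).
  exists (Seq reduction p), ((g + 1) * (c + 1) + c0)%nat.
  intros F HF w Hfx Hw. cbn [instance k_SAT valid answer encode] in *.
  destruct (Hcost F HF) as [HY HT]. destruct (reduce_correct k F HF) as [Hvalid Hans].
  destruct (reduce_sizes F) as (_ & _ & HL & HL5 & Hfo).
  set (T := Rpower 2 ((1 - a / 2) * INR (num_vars F))) in *.
  set (x := encode_cnf F) in *. set (Y := (2 ^ ((num_vars F + 1) / 2) * (length x + 3))%nat) in *.
  set (out := encode_regex (fst (reduce F)) ++ encode_regex (snd (reduce F))) in *.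
  set (TAB := Rpower _ (1 - alpha)) in *.
  assert (HTpos : 0 < T) by apply exp_pos. assert (HTAB : 0 < TAB) by apply exp_pos.
  pose proof (pos_INR (length x)) as Hxpos. pose proof (pos_INR (length out)) as Hopos.
  pose proof (pos_INR c) as Hcpos.
  set (b := 2 + T + INR (length x)) in *. assert (Hb : 2 <= b) by (unfold b; lra).
  assert (HLR : INR (length out) <= 60 * (K * T)).
  { apply le_INR in HL. rewrite mult_INR in HL. replace (INR 60) with 60 in HL by (simpl; ring). lra. }
  assert (Hbg : 130 * K * b <= b ^ (g + 1)).
  { rewrite pow_add, pow_1. apply Rmult_le_compat_r; [lra|].
    apply Rle_trans with (1 := Hg). apply pow_incr; lra. }
  assert (Hexp : forall e, (e <= c + 1)%nat -> (b ^ (g + 1)) ^ e <= 2 ^ w).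
  { intros e He. rewrite <- pow_mult. apply Rle_trans with (2 := Hw).
    apply Rle_pow; [lra|]. nia. }
  assert (Hb1 : b ^ (g + 1) <= 2 ^ w) by (rewrite <- (pow_1 (b ^ (g + 1))); apply Hexp; lia).
  assert (HKb : K * T <= K * b) by (apply Rmult_le_compat_l; unfold b; lra).
  assert (HbK : b <= K * b) by nra.
  assert (Hnat : forall v, INR v <= 2 ^ w -> (v <= 2 ^ w)%nat).
  { intros v Hv. apply INR_le. rewrite pow_INR. exact Hv. }
  assert (Hx2 : (2 * length x + 2 <= 2 ^ w)%nat).
  { apply Hnat. rewrite plus_INR, mult_INR. change (INR 2) with 2. unfold b in *. lra. }
  assert (Ho2 : (2 * length out + 2 <= 2 ^ w)%nat).
  { apply Hnat. rewrite plus_INR, mult_INR. change (INR 2) with 2. lra. }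
  assert (Hw1 : (1 <= w)%nat) by (destruct w; [simpl in Hx2; lia|lia]).
  destruct (runs_reduction w F Hw1 Hfx Hx2 Ho2) as (t1 & Ht1 & Hexec1). fold x out in Ht1, Hexec1.
  destruct (Hp (reduce F)) with (w := w) as (t2 & s & Hexec2 & Ht2 & Hs).
  { exact Hvalid. }
  { cbn [encode homogeneous_intersection]. fold out.
    eapply Forall_impl; [|exact Hfo]. cbn beta. intros v Hv. lia. }
  { cbn [encode homogeneous_intersection]. fold out TAB.
    apply Rle_trans with ((b ^ (g + 1)) ^ c); [|apply Hexp; lia].
    apply pow_incr. split; [lra|]. lra. }
  cbn [encode homogeneous_intersection] in Hexec2, Ht2. fold out in Hexec2, Ht2. fold TAB in Ht2.
  exists (t1 + t2)%nat, s. split; [econstructor; eassumption|]. split.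
  - assert (Ht1Y : (t1 <= 400 * Y)%nat) by (unfold Y; lia).
    apply le_INR in Ht1Y. rewrite mult_INR in Ht1Y. replace (INR 400) with 400 in Ht1Y by (simpl; ring).
    rewrite (plus_INR t1).
    assert (H2 : INR c * (TAB + INR (length out)) <= INR c * (61 * (K * T)))
      by (apply Rmult_le_compat_l; lra).
    apply Rle_trans with (INR c0 * T); [nra|].
    rewrite plus_INR. pose proof (pos_INR ((g + 1) * (c + 1))). pose proof (pos_INR c0).
    apply Rmult_le_compat; lra.
  - etransitivity; [exact Hs|exact Hans].
Qed.

Theorem theorem1 :
  SETH ->
  forall alpha : R, (0 < alpha)%R ->
    ~ solvable_in_time
        (homogeneous_intersection OConcat OPlus OConcat OUnion)
        (fun AB : regex * regex =>
           Rpower (INR (size (fst AB)) * INR (size (snd AB))) (1 - alpha)).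
Proof.
  intros HSETH alpha Halpha Hsolv.
  set (a := Rmin alpha (/ 2)).
  assert (Ha : 0 < a) by (apply Rmin_glb_lt; lra).
  destruct (HSETH (a / 2)) as (k & Hk); [lra|].
  apply Hk, (SAT_solvable_from_intersection k alpha a);
    [exact Ha|apply Rmin_r|apply Rmin_l|exact Hsolv].
Qed.
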